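(* Let $\nu\vdash n$ with $\nu_1=\nu_2$, put $\bar\nu=\nu+(n)$, and let $\lambda\vdash 2n$ with $\lambda_1=n+\nu_1-1$. Then $$\langle s_\nu\circ s_{(2)}\mid s_\lambda\rangle=\begin{cases}1&\text{if }\lambda=\bar\nu-\varepsilon_1-\varepsilon_x+\varepsilon_a+\varepsilon_b\text{ for some }x,a,b\geq 2\text{ with }x\neq a,b\text{ and with }\nu_a\neq\nu_b\text{ if }a\neq b,\\ |I(\lambda)|-1&\text{if }\lambda=\bar\nu-\varepsilon_1+\varepsilon_2,\\ |I(\lambda)|&\text{if }\lambda=\bar\nu-\varepsilon_1+\varepsilon_c\text{ for some }c>2,\\ 0&\text{otherwise.}\end{cases}$$
   Context: $s_\lambda$ is the Schur function of $\lambda$, $\langle\cdot\mid\cdot\rangle$ is the Hall inner product, and $\circ$ is plethysm ($s_\nu\circ s_{(2)}=s_\nu[s_{(2)}]$, with $p_k\circ g=g(x_1^k,x_2^k,\dots)$ and $f\mapsto f\circ g$ a ring homomorphism). Partitions are non-empty and extended by zeros ($\nu_i=0$ for $i>\ell(\nu)$). $\bar\nu=\nu+(n)=(\nu_1+n,\nu_2,\nu_3,\dots)$. $\varepsilon_i$ is the $i$th unit vector, so adding/subtracting $\varepsilon_i$ adds/removes a box in row $i$. $M(\nu)$ is the set of partitions $\beta\vdash 2n$ obtained from $\bar\nu-\varepsilon_1$ by first removing a (removable) node in some row $x>1$ and then adding two nodes, in rows $a\geq b\geq 2$, where $\beta_a\neq\beta_b$ if $a\neq b$; so $\beta=\bar\nu-\varepsilon_1-\varepsilon_x+\varepsilon_a+\varepsilon_b$.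 For $\beta\in M(\nu)$, $I(\beta)$ is the set of all pairs $(a,b)$ with $a\geq b\geq 2$ for which $\beta$ can be obtained in this way (for some $x$, which is determined by $\beta$ and $(a,b)$); $I(\beta)=\emptyset$ if $\beta\notin M(\nu)$. *)

(* Defs.v *)
From HB Require Import structures.
From mathcomp Require Import all_boot all_order all_algebra finmap.
From mathcomp Require Import boolp classical_sets cardinality mpoly.

Set Implicit Arguments.
Unset Strict Implicit.
Unset Printing Implicit Defensive.

Import GRing.Theory.
Local Open Scope ring_scope.

(* Partitions are weakly decreasing sequences of positive integers. Rows are
   numbered from 0 throughout: [nth 0%N nu i] is the part written nu_{i+1} in
   the usual notation, and it is 0 beyond the length of [nu]. *)
Definition is_part_of (n : nat) (nu : seq nat) : bool :=
  [&& sorted geq nu, 0%N \notin nu & sumn nu == n].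

(* A symmetric function in x_1, x_2, ... is given by all its specialisations
   to finitely many variables, as in the description of the ring of symmetric
   functions as an inverse limit of rings of symmetric polynomials. *)
Definition symfun : Type := forall N : nat, {mpoly rat[N]}.

Definition cell (la : seq nat) : finType :=
  {i : 'I_(size la) & 'I_(nth 0%N la i)}.

Definition cell_row (la : seq nat) (c : cell la) : nat := tag c.
Definition cell_col (la : seq nat) (c : cell la) : nat := tagged c.

Definition semistandard (la : seq nat) (N : nat)
    (T : {ffun cell la -> 'I_N}) : bool :=
  [forall c : cell la, forall d : cell la,
     ((cell_row c == cell_row d) && (cell_col c <= cell_col d)%N ==>
        (T c <= T d)%N) &&
     ((cell_col c == cell_col d) && (cell_row c < cell_row d)%N ==>
        (T c < T d)%N)].

Definition schur (la : seq nat) : symfun := fun N =>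
  \sum_(T : {ffun cell la -> 'I_N} | semistandard T) \prod_(c : cell la) 'X_(T c).

Definition powersum (k : nat) : symfun := fun N => \sum_(i < N) 'X_i ^+ k.

Definition powersum_expands (f : symfun)
    (P : {d : nat & {mpoly rat[d]}}) : Prop :=
  forall N, f N = tagged P \mPo [tuple powersum i.+1 N | i < tag P].

(* Over the rationals every symmetric function is a polynomial in the power
   sums p_1, p_2, ..., unique up to the number d of variables it is regarded as
   involving; [powersum_expansion f] is such a polynomial, in p_1, ..., p_d
   (and 0 by convention if f is not a symmetric function). *)
Definition powersum_expansion (f : symfun) : {d : nat & {mpoly rat[d]}} :=
  xget (existT (fun d => {mpoly rat[d]}) 0%N 0) [set P | powersum_expands f P].

(* p_k o g = g(x_1^k, x_2^k, ...) *)
Definition powersum_plethysm (k : nat) (g : symfun) : symfun := fun N =>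
  g N \mPo [tuple 'X_i ^+ k | i < N].

(* f |-> f o g is the ring homomorphism extending the values on power sums *)
Definition plethysm (f g : symfun) : symfun := fun N =>
  let P := powersum_expansion f in
  tagged P \mPo [tuple powersum_plethysm i.+1 g N | i < tag P].

Definition schur_expands (f : symfun)
    (c : {fsfun seq nat -> rat with 0}) : Prop :=
  (forall la, la \in finsupp c -> is_part_of (sumn la) la) /\
  (forall N, f N = \sum_(la <- finsupp c) c la *: schur la N).

(* The Schur functions are a basis of the ring of symmetric functions, so the
   expansion is unique (and 0 by convention if f is not a symmetric function). *)
Definition schur_expansion (f : symfun) : {fsfun seq nat -> rat with 0} :=
  xget [fsfun] [set c | schur_expands f c].

(* The bilinear form for which the Schur functions are orthonormal. *)
Definition hall (f g : symfun) : rat :=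
  \sum_(la <- finsupp (schur_expansion f))
     schur_expansion f la * schur_expansion g la.

(* Integer vectors indexed by rows, compared pointwise. *)
Definition parts (nu : seq nat) (i : nat) : int := (nth 0%N nu i)%:Z.

Definition eps (k i : nat) : int := (i == k)%:Z.

(* nu + (n), for nu a partition of n *)
Definition bar (nu : seq nat) (i : nat) : int :=
  parts nu i + (sumn nu)%:Z * eps 0 i.

Definition removable (v : nat -> int) (x : nat) : Prop := (v x.+1 < v x).

(* beta arises from bar nu - eps_1 by removing a removable node in row x
   (not the first row) and then adding nodes in rows a >= b (not the first
   row), with beta_a <> beta_b if a <> b. *)
Definition obtained (nu beta : seq nat) (x a b : nat) : Prop :=
  [/\ (0 < x)%N, removable (fun i => bar nu i - eps 0 i) x,
      (0 < b <= a)%N,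
      forall i, parts beta i =
        bar nu i - eps 0 i - eps x i + eps a i + eps b i
    & a <> b -> parts beta a <> parts beta b].

Definition Mset (nu : seq nat) : set (seq nat) :=
  [set beta | is_part_of (2 * sumn nu) beta /\
     exists x a b, obtained nu beta x a b]%classic.

Definition Iset (nu beta : seq nat) : set (nat * nat) :=
  [set ab | Mset nu beta /\ exists x, obtained nu beta x ab.1 ab.2]%classic.

(* Main.v *)
Require Import Defs.
From HB Require Import structures.
From mathcomp Require Import all_boot all_order all_algebra finmap.
From mathcomp Require Import boolp classical_sets cardinality mpoly.
From mathcomp Require Import zify ring.

(* Since h_2 is the sum of the monomials x_i x_j with i <= j, the plethysm of
   s_nu with s_(2) is s_nu evaluated at these monomials.  Single out one variable
   x; the monomials become x^2, the x x_i and the x_i x_j, and the branching rule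
   computes the coefficients of the top powers of x.  With v = nu_1 and
   nu^- = (nu_2, nu_3, ...), no power beyond x^(n+v) occurs, x^(n+v) has
   coefficient s_{nu^-}, and the coefficient of x^(n+v-1) is
     sum s_mu + h_2 sum s_rho,
   where mu is nu with a horizontal strip of size v - 1 removed and rho is nu^-
   with a box removed.  In sum_lambda c_lambda s_lambda, the coefficient of x^j is
   made of the c_lambda s_{lambda^-} with lambda_1 = j and of contributions of
   longer first rows.  Linear independence of the Schur functions then gives
   c_lambda = 0 for lambda_1 > n + v, then c_lambda = [lambda = bar nu] for
   lambda_1 = n + v, and finally, as nu_1 = nu_2,
     sum_{lambda_1 = n+v-1} c_lambda s_{lambda^-} = h_2 sum s_rho - s_{nu^- + eps_1}.
   By Pieri's rule, the first term on the right counts the pairs in I(lambda). *)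

Set Implicit Arguments.
Unset Strict Implicit.
Unset Printing Implicit Defensive.

Import GRing.Theory Num.Theory.
Local Open Scope ring_scope.

(** * Interlacing partitions and Pieri's rule *)

(** [powersum_expansion] and [schur_expansion] are choices with default 0, so expansions must first
    be shown to exist. For power sums this follows from Pieri's rule and Newton's identities.
    Whichever polynomial is chosen, it represents s_nu in every number of variables, so the pair
    products may be substituted for the variables. The plethysm has a Schur expansion because
    multiplication by rows, hence by power sums, preserves the span of the Schur functions. The
    branching rule is stated over any commutative ring, so that monomials and polynomials in x can
    serve as letters. The term -1 comes from an incomplete cancellation. The contribution of bar nu
    to the coefficient of x^(n+v-1) is a sum over shapes kappa with |nu^-| + 1 cells. They satisfy
    the inequalities of the shapes mu, except that kappa_1 is bounded by n + v instead of v. As nu_2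
    = v, a first part above v forces kappa = nu^- + eps_1. All other terms cancel against the s_mu,
    and this one survives with a minus sign. *)

Lemma big_bij (R : nmodType) (A B : eqType) (s : seq A) (t : seq B)
    (f : A -> B) (g : B -> A) (F : B -> R) :
  uniq s -> uniq t ->
  (forall x, x \in s -> f x \in t /\ g (f x) = x) ->
  (forall y, y \in t -> g y \in s /\ f (g y) = y) ->
  \sum_(y <- t) F y = \sum_(x <- s) F (f x).
Proof.
move=> us ut fP gP; rewrite -(big_map f predT) /=; apply: perm_big.
apply: uniq_perm => //.
  rewrite map_inj_in_uniq // => x y xs ys e.
  by rewrite -(fP x xs).2 -(fP y ys).2 e.
move=> y; apply/idP/mapP => [yt|[x xs ->]]; last exact: (fP x xs).1.
by exists (g y); [exact: (gP y yt).1 | rewrite (gP y yt).2].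
Qed.

Lemma sumn_nth m s : (size s <= m)%N ->
  sumn s = (\sum_(i < m) nth 0%N s i)%N.
Proof.
elim: s m => [|a s IH] [|m] //= h.
- by rewrite big_ord0.
- by rewrite big1 // => i _; rewrite nth_nil.
- by rewrite big_ord_recl /= (IH m).
Qed.

Lemma nth_leq_sumn s i : (nth 0%N s i <= sumn s)%N.
Proof. by elim: s i => [|a s IH] [|i] //=; [lia | have := IH i; lia]. Qed.

Lemma nth_rcons0 s i : nth 0%N (rcons s 0%N) i = nth 0%N s i.
Proof.
rewrite nth_rcons; case: ltngtP => // [h|->]; first by rewrite nth_default // ltnW.
by rewrite nth_default.
Qed.

Lemma leq_sumn s t : (forall i, nth 0%N s i <= nth 0%N t i)%N ->
  (sumn s <= sumn t)%N.
Proof.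
move=> h; rewrite (@sumn_nth (maxn (size s) (size t)) s) ?leq_maxl //.
by rewrite (@sumn_nth (maxn (size s) (size t)) t) ?leq_maxr // leq_sum.
Qed.

Lemma eq_sumn s t : (forall i, nth 0%N s i = nth 0%N t i) -> sumn s = sumn t.
Proof. by move=> h; apply/eqP; rewrite eqn_leq !leq_sumn // => i; rewrite h. Qed.

Lemma sumn_leq_eq s t : (forall i, nth 0%N s i <= nth 0%N t i)%N ->
  (sumn t <= sumn s)%N -> forall i, nth 0%N s i = nth 0%N t i.
Proof.
elim: s t => [|a s IH] [|b t] //= h le i.
- by rewrite nth_nil; have := nth_leq_sumn (b :: t) i; rewrite /= in le *; lia.
- have := nth_leq_sumn (a :: s) i; have := leq_sumn h.
  have := h i; rewrite nth_nil /=; lia.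
- have h' j : (nth 0 s j <= nth 0 t j)%N by exact: (h j.+1).
  have := h 0%N => /= h0; have := leq_sumn h' => h1.
  have eab : a = b by lia.
  by case: i => [|i] //=; apply: IH => //; lia.
Qed.

Lemma sorted_geqP s :
  reflect (forall i, nth 0%N s i.+1 <= nth 0%N s i)%N (sorted geq s).
Proof.
apply: (iffP (sortedP 0%N)) => h i; last by move=> _; apply: h.
have [lt|ge] := ltnP i.+1 (size s); first exact: h.
by rewrite nth_default.
Qed.

Lemma geq_nth s i j : sorted geq s -> (i <= j)%N ->
  (nth 0%N s j <= nth 0%N s i)%N.
Proof.
move=> /sorted_geqP h; elim: j => [|j IH]; first by rewrite leqn0 => /eqP ->.
by rewrite leq_eqVlt => /orP[/eqP -> //|/IH]; apply: leq_trans.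
Qed.

(** A finite search space, so that [inter] and [up] are duplicate-free lists obtained by
    filtering. *)
Fixpoint box (l b : nat) : seq (seq nat) :=
  if l is l'.+1 then [seq a :: s | a <- iota 0 b.+1, s <- box l' b]
  else [:: [::]].

Lemma mem_box l b s : (s \in box l b) = (size s == l) && all (leq^~ b) s.
Proof.
elim: l s => [|l IH] s; first by case: s.
rewrite [box _ _]/(allpairs _ _ _); apply/allpairsP/idP.
  move=> [[a s'] [ai si ->]]; move: ai si; rewrite mem_iota add0n ltnS IH /=.
  by move=> ab /andP[/eqP <- ss]; rewrite eqxx ab.
case: s => [|a s] //; rewrite eqSS /= andbCA -IH => /andP[ab ss].
by exists (a, s); split; rewrite ?(mem_iota 0 b.+1).
Qed.

Lemma uniq_box l b : uniq (box l b).
Proof.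
elim: l => // l IH; rewrite [box _ _]/(allpairs _ _ _).
apply: allpairs_uniq => //; first exact: iota_uniq.
by move=> [x y] [x' y'] _ _ [-> ->].
Qed.

(** The skew shape la/ka is a horizontal strip. Beyond the tested indices all entries are 0. *)
Definition interlacing (la ka : seq nat) : bool :=
  all (fun i => nth 0 la i.+1 <= nth 0 ka i <= nth 0 la i)%N
    (iota 0 (maxn (size la) (size ka))).

Lemma interlacingP la ka :
  reflect (forall i, nth 0%N la i.+1 <= nth 0%N ka i <= nth 0%N la i)%N
    (interlacing la ka).
Proof.
apply: (iffP allP) => [h i|h i _]; last exact: h.
have [lt|ge] := ltnP i (maxn (size la) (size ka)); first by apply: h; rewrite mem_iota.
by rewrite !nth_default //; lia.
Qed.

(** Results keep the length of [la], padded with zeros, so that each removal of a horizontal strip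
    is listed once; [schur_at_ext] and [strip] absorb the padding. *)
Definition inter (la : seq nat) : seq (seq nat) :=
  [seq ka <- box (size la) (sumn la) | interlacing la ka].

Lemma mem_inter la ka :
  (ka \in inter la) = (size ka == size la) && interlacing la ka.
Proof.
rewrite mem_filter mem_box andbCA; case: eqP => //= es.
apply/andP/idP => [[]//|h]; split=> //.
apply/(all_nthP 0%N) => i _; have /interlacingP/(_ i) := h.
by have := nth_leq_sumn la i; lia.
Qed.

Lemma uniq_inter la : uniq (inter la).
Proof. exact/filter_uniq/uniq_box. Qed.

Lemma interlacing_sorted la ka : interlacing la ka -> sorted geq ka.
Proof.
by move=> /interlacingP h; apply/sorted_geqP => i; have := h i; have := h i.+1; lia.
Qed.

Lemma sorted_inter la ka : ka \in inter la -> sorted geq ka.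
Proof. by rewrite mem_inter => /andP[_ /interlacing_sorted]. Qed.

Lemma sumn_inter la ka : ka \in inter la -> (sumn ka <= sumn la)%N.
Proof.
rewrite mem_inter => /andP[_ /interlacingP h].
by apply: leq_sumn => i; have := h i; lia.
Qed.

(** A horizontal strip creates at most one new row, hence the length [(size mu).+1]; that row may be
    empty. *)
Definition up (k : nat) (mu : seq nat) : seq (seq nat) :=
  [seq la <- box (size mu).+1 (sumn mu + k) |
     (sumn la == sumn mu + k)%N && interlacing la mu].

Lemma mem_up k mu la : (la \in up k mu) =
  [&& size la == (size mu).+1, sumn la == (sumn mu + k)%N & interlacing la mu].
Proof.
rewrite mem_filter mem_box -!andbA; case: (size la == _); rewrite ?andbF //=.
case: eqP => //= es; case: interlacing => //=.
apply/(all_nthP 0%N) => i _; have := nth_leq_sumn la i; lia.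
Qed.

Lemma uniq_up k mu : uniq (up k mu).
Proof. exact/filter_uniq/uniq_box. Qed.

Lemma sorted_up k mu la : sorted geq mu -> la \in up k mu -> sorted geq la.
Proof.
rewrite mem_up => _ /and3P[_ _ /interlacingP h].
by apply/sorted_geqP => i; have := h i; lia.
Qed.

Section Values.
Variable R : comNzRingType.

(* The value of the Schur function of la at xs, computed by the branching rule,
   the head of xs being the largest letter. *)
Fixpoint schur_at (xs : seq R) (la : seq nat) : R :=
  if xs is x :: xs' then
    \sum_(ka <- inter la) x ^+ (sumn la - sumn ka) * schur_at xs' ka
  else (sumn la == 0)%:R.

Lemma big_inter1 (F : seq nat -> R) k :
  \sum_(ka <- inter [:: k]) F ka = \sum_(b <- iota 0 k.+1) F [:: b].
Proof.
apply: (big_bij (f := fun b => [:: b]) (g := head 0%N)).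
- exact: iota_uniq.
- exact: uniq_inter.
- move=> b; rewrite (mem_iota 0 k.+1) => bk; split=> //.
  by rewrite mem_inter /=; apply/interlacingP => -[|[|i]] /=; lia.
- move=> [|b [|c s]]; rewrite mem_inter //= => /interlacingP h; split=> //.
  by have := h 0%N; rewrite (mem_iota 0 k.+1) /=; lia.
Qed.

Lemma schur_at_row x xs k : schur_at (x :: xs) [:: k] =
  \sum_(b <- iota 0 k.+1) x ^+ (k - b) * schur_at xs [:: b].
Proof. by rewrite /= big_inter1; apply: eq_bigr => b _ /=; rewrite !addn0. Qed.

End Values.

Lemma up_null mu : sumn mu = 0%N ->
  perm_eq (up 0 mu) [:: nseq (size mu).+1 0%N].
Proof.
move=> mu0; apply: uniq_perm => //; first exact: uniq_up.
move=> la; rewrite mem_up inE addn0 mu0; apply/and3P/eqP => [[/eqP sz /eqP la0 _]|->].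
  apply: (@eq_from_nth _ 0%N) => [|i]; rewrite ?size_nseq // sz => lt.
  by rewrite nth_nseq lt; have := nth_leq_sumn la i; lia.
rewrite size_nseq sumn_nseq mul0n; split=> //; apply/interlacingP => i.
by have := nth_leq_sumn mu i; rewrite !nth_nseq !if_same; lia.
Qed.

(** Used with [c i] the sum of the end points of an interval containing the i-th entry, which is
    thereby reflected in its interval. *)
Definition reflect_seq (c : nat -> nat) l (s : seq nat) :=
  mkseq (fun i => c i - nth 0%N s i)%N l.

Lemma nth_reflect_seq c l s i : (forall j, (l <= j)%N -> c j = 0%N) ->
  nth 0%N (reflect_seq c l s) i = (c i - nth 0%N s i)%N.
Proof.
move=> c0; have [lt|ge] := ltnP i l; first by rewrite nth_mkseq.
by rewrite nth_default ?size_mkseq // c0.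
Qed.

Lemma sumn_reflect_seq c l s : (forall i, nth 0%N s i <= c i)%N ->
  size s = l ->
  (sumn (reflect_seq c l s) + sumn s = \sum_(i < l) c i)%N.
Proof.
move=> h sz; rewrite (@sumn_nth l) ?size_mkseq // (@sumn_nth l s) ?sz //.
by rewrite -big_split /=; apply: eq_bigr => i _; rewrite nth_mkseq // subnK.
Qed.

Lemma reflect_seqK c l s : (forall i, nth 0%N s i <= c i)%N -> size s = l ->
  reflect_seq c l (reflect_seq c l s) = s.
Proof.
move=> h sz; apply: (@eq_from_nth _ 0%N); rewrite ?size_mkseq // => i lt.
by rewrite !nth_mkseq // subKn.
Qed.

Section Toggle.
Variables (k : nat) (mu : seq nat).

(* For fixed rho, both kappa_i (with kappa below mu and rho) and lambda_{i+1}
   (with lambda above mu and rho) range over the interval from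
   max(mu_{i+1}, rho_{i+1}) to min(mu_i, rho_i); reflecting this interval
   exchanges the two, and lambda_1 is free to absorb the size. *)
Definition toggle_bound (rho : seq nat) i :=
  (maxn (nth 0 mu i.+1) (nth 0 rho i.+1) + minn (nth 0 mu i) (nth 0 rho i))%N.

Definition toggle_up (t : (nat * seq nat) * seq nat) : seq nat * seq nat :=
  ((maxn (nth 0 mu 0) (nth 0 t.2 0) + (k - t.1.1))%N ::
     reflect_seq (toggle_bound t.2) (size mu) t.1.2, t.2).

Definition toggle_down (t : seq nat * seq nat) : (nat * seq nat) * seq nat :=
  let ka := reflect_seq (toggle_bound t.2) (size mu) (behead t.1) in
  ((sumn t.2 - sumn ka, ka), t.2)%N.

(** Both lists index the terms s_rho left after splitting off the head letter x: [down_up] for h_k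
    s_mu, with b and [ka] the parts of the row and of [mu] that avoid x, and [up_down] for the right
    side of Pieri's rule. The power of x is |mu| + k - |rho| in both, so a bijection fixing rho
    suffices. *)
Definition down_up := [seq (t, rho) |
  t <- [seq (b, ka) | b <- iota 0 k.+1, ka <- inter mu], rho <- up t.1 t.2].

Definition up_down := [seq (la, rho) | la <- up k mu, rho <- inter la].

Lemma mem_down_up b ka rho : (((b, ka), rho) \in down_up) =
  [&& (b <= k)%N, ka \in inter mu & rho \in up b ka].
Proof.
apply/allpairsPdep/and3P => [[t [r [/allpairsP[[b' ka'] [bi ki ->]] ri [-> -> ->]]]]|[bi ki ri]].
  by move: bi; rewrite mem_iota /= ltnS.
exists (b, ka), rho; split=> //; apply/allpairsP; exists (b, ka).
by split=> //; rewrite mem_iota /= ltnS.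
Qed.

Lemma mem_up_down la rho :
  ((la, rho) \in up_down) = (la \in up k mu) && (rho \in inter la).
Proof.
apply/allpairsPdep/andP => [[l [r [li ri [-> ->]]]] //|[li ri]].
by exists la, rho.
Qed.

Lemma addn_max_min m n : (maxn m n + minn m n = m + n)%N.
Proof. lia. Qed.

(** In each row, max + min is the sum of the two entries. The bounds pair the min of a row with the
    max of the next one, so only the max of the first row is left over, and this is what [toggle_up]
    puts into lambda_1. *)
Lemma sum_toggle_bound rho : size rho = (size mu).+1 ->
  (maxn (nth 0 mu 0) (nth 0 rho 0) + \sum_(i < size mu) toggle_bound rho i =
   sumn mu + sumn rho)%N.
Proof.
move=> sz; rewrite (@sumn_nth (size mu).+1 mu) // (@sumn_nth (size mu).+1 rho) ?sz //.
rewrite -big_split /=.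
under [RHS]eq_bigr => i _ do rewrite -addn_max_min.
rewrite [RHS]big_split /= big_ord_recl big_ord_recr /=.
rewrite (nth_default _ (leqnn (size mu))) min0n addn0 -addnA -big_split /=.
by congr (_ + _)%N; apply: eq_bigr.
Qed.

Lemma toggle_bound0 rho j : size rho = (size mu).+1 -> (size mu <= j)%N ->
  toggle_bound rho j = 0%N.
Proof.
move=> sz h; rewrite /toggle_bound (nth_default _ h) (nth_default _ (leqW h)).
by rewrite (@nth_default _ _ rho) ?sz //; lia.
Qed.

Lemma toggle_upK t : t \in down_up ->
  toggle_up t \in up_down /\ toggle_down (toggle_up t) = t.
Proof.
case: t => [[b ka] rho]; rewrite mem_down_up => /and3P[bk].
rewrite mem_inter mem_up => /andP[/eqP sz /interlacingP hm].
move=> /and3P[/eqP szr /eqP sr /interlacingP hr].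
have szr' : size rho = (size mu).+1 by rewrite szr sz.
have ub i : (nth 0 ka i <= toggle_bound rho i)%N.
  by have := hm i; have := hr i; rewrite /toggle_bound; lia.
have nr i := @nth_reflect_seq _ _ ka i (fun j => @toggle_bound0 rho j szr').
have st := sum_toggle_bound szr'.
have sumr := sumn_reflect_seq ub sz.
split; last first.
  rewrite /toggle_down /= reflect_seqK //; congr (_, _, _); lia.
rewrite mem_up_down mem_up mem_inter /= size_mkseq szr' !eqxx /= -andbA.
apply/and3P; split.
- by apply/eqP; rewrite /=; lia.
- apply/interlacingP => -[|i] /=; rewrite !nr.
    by have := hm 0%N; have := hr 0%N; rewrite /toggle_bound; lia.
  have := hm i; have := hr i; have := hm i.+1; have := hr i.+1.
  by rewrite /toggle_bound; lia.
- apply/interlacingP => -[|i] /=; rewrite !nr.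
    by have := hm 0%N; have := hr 0%N; rewrite /toggle_bound; lia.
  have := hm i; have := hr i; have := hm i.+1; have := hr i.+1.
  by rewrite /toggle_bound; lia.
Qed.

Lemma toggle_downK t : t \in up_down ->
  toggle_down t \in down_up /\ toggle_up (toggle_down t) = t.
Proof.
case: t => [la rho]; rewrite mem_up_down mem_up mem_inter.
move=> /andP[/and3P[/eqP sz /eqP sl /interlacingP hm] /andP[/eqP szr /interlacingP hr]].
have szr' : size rho = (size mu).+1 by rewrite szr sz.
case: la sz sl hm hr szr => [|l0 la] //= [sz] sl hm hr _.
have ub i : (nth 0 la i <= toggle_bound rho i)%N.
  by have := hm i; have := hr i; rewrite /toggle_bound /=; lia.
have nr i := @nth_reflect_seq _ _ la i (fun j => @toggle_bound0 rho j szr').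
have st := sum_toggle_bound szr'.
have sumr := sumn_reflect_seq ub sz.
have h0 := hm 0%N; have h0' := hr 0%N; rewrite /= in h0 h0'.
have hk : interlacing rho (reflect_seq (toggle_bound rho) (size mu) la).
  apply/interlacingP => i; rewrite !nr.
  have := hm i; have := hr i; have := hm i.+1; have := hr i.+1.
  by rewrite /toggle_bound /=; lia.
have le : (sumn (reflect_seq (toggle_bound rho) (size mu) la) <= sumn rho)%N.
  by apply: leq_sumn => i; move/interlacingP: hk => /(_ i); lia.
split; last first.
  rewrite /toggle_up /toggle_down /= reflect_seqK //; congr (_ :: _, _); lia.
rewrite /toggle_down mem_down_up mem_up mem_inter /= size_mkseq szr' !eqxx /=.
rewrite hk andbT; apply/and3P; split; try lia.
apply/interlacingP => i; rewrite !nr.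
have := hm i; have := hr i; have := hm i.+1; have := hr i.+1.
by rewrite /toggle_bound /=; lia.
Qed.

End Toggle.

(** Induction on the alphabet: once the head letter is split off, the rule for [xs] expands each h_b
    s_ka, and the toggle matches the terms with those on the right. *)
Theorem pieri (R : comNzRingType) (xs : seq R) mu k : sorted geq mu ->
  schur_at xs [:: k] * schur_at xs mu = \sum_(la <- up k mu) schur_at xs la.
Proof.
elim: xs mu k => [|x xs IH] mu k smu.
  rewrite /= addn0 -natrM mulnb -addn_eq0 addnC.
  have -> : \sum_(la <- up k mu) (sumn la == 0)%:R =
            \sum_(la <- up k mu) (sumn mu + k == 0)%:R :> R.
    by apply: eq_big_seq => la; rewrite mem_up => /and3P[_ /eqP -> _].
  case: eqP => [|_]; last by rewrite big1.
  move=> /eqP; rewrite addn_eq0 => /andP[/eqP mu0 /eqP ->].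
  by rewrite (perm_big _ (up_null mu0)) big_seq1.
transitivity (\sum_(t <- down_up k mu)
    x ^+ (sumn mu + k - sumn t.2) * schur_at xs t.2).
  rewrite schur_at_row /= big_allpairs_dep big_allpairs_dep /= mulr_suml.
  apply: eq_big_seq => b; rewrite (mem_iota 0 k.+1) add0n ltnS => /andP[_ bk].
  rewrite mulr_sumr; apply: eq_big_seq => ka kai.
  rewrite mulrACA -exprD IH ?(sorted_inter kai) // mulr_sumr.
  apply: eq_big_seq => rho; rewrite mem_up => /and3P[_ /eqP -> _].
  by congr (_ ^+ _ * _); have := sumn_inter kai; lia.
have := @big_bij _ _ _ (down_up k mu) (up_down k mu) (toggle_up k mu)
  (toggle_down mu) (fun t => x ^+ (sumn mu + k - sumn t.2) * schur_at xs t.2).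
move=> <-; last 1 first.
- exact: toggle_downK.
- rewrite big_allpairs_dep; apply: eq_big_seq => la /=.
  by rewrite mem_up => /and3P[_ /eqP -> _].
- apply: allpairs_uniq_dep => [|t _|[x1 y1] [x2 y2] _ _ [-> ->]] //.
    apply: allpairs_uniq; rewrite ?iota_uniq ?uniq_inter //.
    by move=> [x1 y1] [x2 y2] _ _ [-> ->].
  exact: uniq_up.
- apply: allpairs_uniq_dep => [|t _|[x1 y1] [x2 y2] _ _ [-> ->]] //.
    exact: uniq_up.
  exact: uniq_inter.
- exact: toggle_upK.
Qed.

(** * Semistandard tableaux *)

Lemma cell_inj (s : seq nat) (c d : cell s) :
  cell_row c = cell_row d -> cell_col c = cell_col d -> c = d.
Proof.
case: c d => [i j] [i' j']; rewrite /cell_row /cell_col /= => /val_inj e.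
by case: i' / e j' => j' /val_inj ->.
Qed.

Lemma cell_col_lt (s : seq nat) (c : cell s) :
  (cell_col c < nth 0 s (cell_row c))%N.
Proof. by case: c => i j; apply: ltn_ord. Qed.

Lemma ltn_size_nth (s : seq nat) i j : (j < nth 0 s i)%N -> (i < size s)%N.
Proof. by rewrite ltnNge => h; rewrite ltnNge; apply: contra h => /(nth_default 0%N) ->. Qed.

Definition mkcell (s : seq nat) i j (h : (j < nth 0 s i)%N) : cell s :=
  @existT 'I_(size s) (fun i => 'I_(nth 0%N s i)) (Ordinal (ltn_size_nth h)) (Ordinal h).

Definition cell_at (s : seq nat) (i j : nat) : option (cell s) :=
  [pick c : cell s | (cell_row c == i) && (cell_col c == j)].

Variant cell_at_spec (s : seq nat) i j : option (cell s) -> bool -> Type :=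
| CellAtSome c of cell_row c = i & cell_col c = j : cell_at_spec i j (Some c) true
| CellAtNone : cell_at_spec i j None false.

Lemma cell_atP (s : seq nat) i j :
  cell_at_spec i j (cell_at s i j) (j < nth 0 s i)%N.
Proof.
rewrite /cell_at; case: pickP => [c /andP[/eqP ri /eqP cj]|no].
  by rewrite -{2}ri -{2}cj cell_col_lt; constructor.
case: (ltnP j) => [h|_]; last by constructor.
by have := no (mkcell h); rewrite /cell_row /cell_col /= !eqxx.
Qed.

Lemma card_cell (s : seq nat) : #|cell s| = sumn s.
Proof.
rewrite card_tagged sumnE big_map big_enum (sumn_nth (leqnn _)).
by apply: eq_bigr => i _; rewrite card_ord.
Qed.

Section Tableaux.
Variable R : comNzRingType.

(** The weights are a function on all of [nat], so that discarding the largest letter leaves [x]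
    unchanged. *)
Definition tableau_sum (la : seq nat) (N : nat) (x : nat -> R) : R :=
  \sum_(T : {ffun cell la -> 'I_N} | semistandard T) \prod_c x (T c).

Lemma tableau_sum0 la x : tableau_sum la 0 x = (sumn la == 0)%:R.
Proof.
rewrite /tableau_sum; case: eqP => [la0|lan0].
  have nocell : cell la -> False by move=> c; have := cell_col_lt c; have := nth_leq_sumn la (cell_row c); lia.
  have T0 : {ffun cell la -> 'I_0} by apply: finfun => c; case: (nocell c).
  rewrite (big_pred1 T0) => [|T].
    by rewrite big1 // => c; case: (nocell c).
  have -> : T = T0 by apply/ffunP => c; case: (nocell c).
  by rewrite /= eqxx; apply/forallP => c; case: (nocell c).
rewrite big_pred0 // => T; exfalso.
have /card_gt0P[c _] : (0 < #|cell la|)%N by rewrite card_cell lt0n; apply/eqP.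
by case: (T c).
Qed.

Section Branching.
Variables (la : seq nat) (N : nat).
Hypothesis la_sorted : sorted geq la.

Definition has_shape (T : {ffun cell la -> 'I_N.+1}) (ka : seq nat) : bool :=
  [forall c, (T c < N)%N == (cell_col c < nth 0 ka (cell_row c))%N].

Definition extend (ka : seq nat) (U : {ffun cell ka -> 'I_N}) :
    {ffun cell la -> 'I_N.+1} :=
  [ffun c => if cell_at ka (cell_row c) (cell_col c) is Some c'
             then widen_ord (leqnSn N) (U c') else ord_max].

Lemma semistandardP (s : seq nat) M (T : {ffun cell s -> 'I_M}) :
  reflect (forall c d,
    (cell_row c = cell_row d -> cell_col c <= cell_col d -> T c <= T d)%N /\
    (cell_col c = cell_col d -> cell_row c < cell_row d -> T c < T d)%N)
  (semistandard T).
Proof.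
apply: (iffP forallP) => [h c d|h c].
  have /forallP/(_ d)/andP[/implyP h1 /implyP h2] := h c.
  by split=> [/eqP e l|/eqP e l]; [apply: h1; rewrite e | apply: h2; rewrite e].
apply/forallP => d; have [h1 h2] := h c d.
by apply/andP; split; apply/implyP => /andP[/eqP e l]; [apply: h1|apply: h2].
Qed.

(** Rows increase weakly, so the largest letter [N] fills a final segment of each row; [ka] records
    where it starts. *)
Lemma shape_exists T : semistandard T -> exists2 ka, ka \in inter la & has_shape T ka.
Proof.
move=> /semistandardP ss.
pose big i j := if cell_at la i j is Some c then (N <= T c)%N else true.
pose ka := mkseq (fun i => find (big i) (iota 0 (nth 0%N la i))) (size la).
have kaE i : nth 0%N ka i = find (big i) (iota 0 (nth 0%N la i)).
  have [lt|ge] := ltnP i (size la); first by rewrite nth_mkseq.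
  by rewrite nth_default ?size_mkseq // [nth 0%N la i]nth_default.
have kale i : (nth 0 ka i <= nth 0 la i)%N.
  by rewrite kaE; apply: leq_trans (find_size _ _) _; rewrite size_iota.
have shape c : (T c < N)%N = (cell_col c < nth 0 ka (cell_row c))%N.
  rewrite kaE; apply/idP/idP => [lt|/(before_find 0%N)].
    rewrite ltnNge; apply/negP => le.
    have hs : has (big (cell_row c)) (iota 0 (nth 0%N la (cell_row c))).
      by rewrite has_find size_iota; apply: leq_ltn_trans le (cell_col_lt c).
    have lf : (find (big (cell_row c)) (iota 0 (nth 0%N la (cell_row c))) <
               nth 0%N la (cell_row c))%N by move: hs; rewrite has_find size_iota.
    have := nth_find 0%N hs; rewrite nth_iota // add0n /big -/(big _).
    move: lf; case: cell_atP => [d dr dc _|//] leNd.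
    by have := (ss d c).1 dr; rewrite dc le => /(_ isT); lia.
  rewrite nth_iota ?cell_col_lt // add0n /big; case: cell_atP => [d dr dc|//].
  by rewrite (cell_inj dr dc) ltnNge => ->.
exists ka; last by apply/forallP => c; rewrite shape.
rewrite mem_inter size_mkseq eqxx; apply/interlacingP => i; rewrite kale andbT.
(* Otherwise the cell of row i in column ka_i contains [N], and the cell below it, also in [la],
   would need a larger letter. *)
rewrite leqNgt; apply/negP => lt.
have lt' : (nth 0 ka i < nth 0 la i)%N.
  by apply: leq_trans lt _; move/sorted_geqP: la_sorted.
have := (ss (mkcell lt') (mkcell lt)).2 erefl (ltnSn _).
have := shape (mkcell lt'); rewrite [cell_col _]/= [cell_row _]/= ltnn.
by have := ltn_ord (T (mkcell lt)); lia.
Qed.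

Lemma shape_unique T ka ka' : ka \in inter la -> ka' \in inter la ->
  has_shape T ka -> has_shape T ka' -> ka = ka'.
Proof.
rewrite !mem_inter => /andP[/eqP sz /interlacingP hk] /andP[/eqP sz' /interlacingP hk'].
move=> /forallP s /forallP s'; apply: (@eq_from_nth _ 0%N); first by rewrite sz.
have E c := etrans (esym (eqP (s c))) (eqP (s' c)).
move=> i _; have [lt|lt|//] := ltngtP (nth 0%N ka i) (nth 0%N ka' i).
  have h : (nth 0 ka i < nth 0 la i)%N by have := hk' i; lia.
  by have := E (mkcell h); rewrite [cell_col _]/= [cell_row _]/= ltnn lt.
have h : (nth 0 ka' i < nth 0 la i)%N by have := hk i; lia.
by have := E (mkcell h); rewrite [cell_col _]/= [cell_row _]/= ltnn lt.
Qed.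

Section Fixed.
Variable ka : seq nat.
Hypothesis ka_inter : ka \in inter la.

Let ka_le i : (nth 0 ka i <= nth 0 la i)%N.
Proof. by move: ka_inter; rewrite mem_inter => /andP[_ /interlacingP/(_ i)]; lia. Qed.

Definition embed (c : cell ka) : cell la :=
  mkcell (leq_trans (cell_col_lt c) (ka_le (cell_row c))).

Lemma extendE U c c' : cell_row c' = cell_row c -> cell_col c' = cell_col c ->
  extend (ka := ka) U c = widen_ord (leqnSn N) (U c').
Proof.
move=> er ec; have h : (cell_col c < nth 0 ka (cell_row c))%N.
  by rewrite -er -ec cell_col_lt.
rewrite ffunE; move: h; case: cell_atP => [d dr dc _|//].
by rewrite (@cell_inj _ d c') ?dr ?dc.
Qed.

Lemma extend_out U c : (nth 0 ka (cell_row c) <= cell_col c)%N ->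
  extend (ka := ka) U c = ord_max.
Proof. by rewrite leqNgt ffunE; case: cell_atP. Qed.

Lemma extend_shape U : has_shape (extend (ka := ka) U) ka.
Proof.
apply/forallP => c; have [h|h] := ltnP (cell_col c) (nth 0 ka (cell_row c)).
  by rewrite (extendE _ (c' := mkcell h)) //= ltn_ord.
by rewrite extend_out //= ltnn.
Qed.

Lemma extend_inj : injective (@extend ka).
Proof.
move=> U V e; apply/ffunP => c; apply: val_inj.
have /(congr1 val) := congr1 (fun f : {ffun _} => f (embed c)) e.
by rewrite !(extendE _ (c' := c)).
Qed.

(** By interlacing, all cells above a cell outside [ka] lie in [ka], so filling the strip with the
    largest letter keeps the columns strict. *)
Lemma extend_semistandard U : semistandard U -> semistandard (extend (ka := ka) U).
Proof.
move: ka_inter; rewrite mem_inter => /andP[_ hk] /semistandardP ss.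
have /interlacingP hi := hk; have ska := interlacing_sorted hk.
apply/semistandardP => c d.
have [hd|hd] := ltnP (cell_col d) (nth 0 ka (cell_row d)); last first.
  rewrite (extend_out U hd); split=> [_ _|ec lr]; first by rewrite /= -ltnS.
  have hc : (cell_col c < nth 0 ka (cell_row c))%N.
    rewrite ec; apply: leq_trans (cell_col_lt d) _.
    by have := geq_nth la_sorted lr; have := hi (cell_row c); lia.
  by rewrite (extendE _ (c' := mkcell hc)) //= ltn_ord.
split=> [er|ec] l.
  have hc : (cell_col c < nth 0 ka (cell_row c))%N by rewrite er; apply: leq_ltn_trans l hd.
  rewrite (extendE _ (c' := mkcell hc)) // (extendE _ (c' := mkcell hd)) //=.
  exact: (ss (mkcell hc) (mkcell hd)).1.
have hc : (cell_col c < nth 0 ka (cell_row c))%N.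
  by rewrite ec; apply: leq_trans hd (geq_nth ska (ltnW l)).
rewrite (extendE _ (c' := mkcell hc)) // (extendE _ (c' := mkcell hd)) //=.
exact: (ss (mkcell hc) (mkcell hd)).2.
Qed.

Lemma extend_onto T : semistandard T -> has_shape T ka ->
  exists2 U, semistandard U & T = extend (ka := ka) U.
Proof.
move=> /semistandardP ss /forallP sh.
have lt c : (T (embed c) < N)%N by rewrite (eqP (sh _)); exact: cell_col_lt c.
pose U : {ffun cell ka -> 'I_N} := [ffun c => Ordinal (lt c)].
exists U; first by apply/semistandardP => c d; rewrite !ffunE; exact: (ss (embed c) (embed d)).
apply/ffunP => c; apply: val_inj => /=.
have [h|h] := ltnP (cell_col c) (nth 0 ka (cell_row c)).
  rewrite (extendE _ (c' := mkcell h)) //= ffunE /=; congr (nat_of_ord (T _)).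
  exact: cell_inj.
rewrite extend_out //=; apply/eqP; rewrite eqn_leq -ltnS ltn_ord /=.
by rewrite leqNgt (eqP (sh c)) -leqNgt.
Qed.

Lemma prod_extend (x : nat -> R) U :
  \prod_c x (extend (ka := ka) U c) =
  x N ^+ (sumn la - sumn ka) * \prod_c x (U c).
Proof.
pose inside (c : cell la) := (cell_col c < nth 0 ka (cell_row c))%N.
have embI : injective embed.
  by move=> c d e; apply: cell_inj; [have := congr1 (@cell_row la) e | have := congr1 (@cell_col la) e].
have imE : embed @: [set: cell ka] = [set c | inside c].
  apply/setP => c; rewrite inE; apply/imsetP/idP => [[d _ ->]|h].
    exact: cell_col_lt.
  by exists (mkcell h) => //; apply: cell_inj.
rewrite (bigID inside) /= mulrC; congr (_ * _).
  rewrite (eq_bigr (fun=> x N)) => [|c]; last first.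
    by rewrite -leqNgt => h; rewrite extend_out.
  rewrite prodr_const; congr (_ ^+ _).
  have := cardC inside; rewrite card_cell.
  have -> : #|inside| = sumn ka.
    rewrite -(card_cell ka) -cardsT -(card_imset _ embI) imE.
    by apply: eq_card => c; rewrite inE.
  by move=> <-; rewrite addKn; apply: eq_card => c.
transitivity (\prod_(c in embed @: [set: cell ka]) x (extend (ka := ka) U c)).
  by apply: eq_bigl => c; rewrite imE inE.
rewrite big_imset /=; last by move=> c d _ _; apply: embI.
rewrite (eq_bigl xpredT) => [|c]; last by rewrite inE.
by apply: eq_bigr => c _; rewrite (extendE _ (c' := c)).
Qed.

Lemma sum_shape (x : nat -> R) :
  \sum_(T : {ffun cell la -> 'I_N.+1} | semistandard T && has_shape T ka)
     \prod_c x (T c) =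
  x N ^+ (sumn la - sumn ka) * tableau_sum ka N x.
Proof.
pose A := [set U : {ffun cell ka -> 'I_N} | semistandard U].
transitivity (\sum_(T in @extend ka @: A) \prod_c x (T c)).
  apply: eq_bigl => T; apply/andP/imsetP => [[ss sh]|[U]].
    have [U sU ->] := extend_onto ss sh; exists U => //.
    by rewrite inE.
  by rewrite inE => sU ->; rewrite extend_semistandard ?extend_shape.
rewrite big_imset /=; last by move=> U V _ _; apply: extend_inj.
rewrite /tableau_sum mulr_sumr; apply: eq_big => [U|U _]; first by rewrite inE.
exact: prod_extend.
Qed.

End Fixed.

(** The tableaux are grouped by the shape that the letters below the largest one fill. *)
Lemma tableau_sum_branch (x : nat -> R) : tableau_sum la N.+1 x =
  \sum_(ka <- inter la) x N ^+ (sumn la - sumn ka) * tableau_sum ka N x.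
Proof.
transitivity (\sum_(T : {ffun cell la -> 'I_N.+1} | semistandard T)
    \sum_(ka <- inter la | has_shape T ka) \prod_c x (T c)).
  apply: eq_bigr => T ss; have [ka ki sh] := shape_exists ss.
  rewrite -[RHS]big_filter (perm_big [:: ka]) ?big_seq1 //=.
  apply: uniq_perm => [||ka'] //; first exact/filter_uniq/uniq_inter.
  rewrite mem_filter inE; apply/andP/eqP => [[sh' ki']|->] //.
  exact: shape_unique sh' sh.
rewrite (exchange_big_dep xpredT) //=; apply: eq_big_seq => ka ki.
by rewrite -sum_shape.
Qed.

End Branching.

(** The list is reversed because [schur_at] splits off its head, which has to be the largest
    letter. *)
Lemma tableau_sumE la N (x : nat -> R) : sorted geq la ->
  tableau_sum la N x = schur_at (rev (mkseq x N)) la.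
Proof.
elim: N la => [|N IH] la sla; first by rewrite tableau_sum0.
rewrite tableau_sum_branch // mkseqS rev_rcons /=.
by apply: eq_big_seq => ka ki; rewrite IH // (sorted_inter ki).
Qed.

End Tableaux.

#[local] Arguments schur_at : simpl never.

(** * Newton's identities *)

Lemma rmorph_schur_at (R S : comNzRingType) (f : {rmorphism R -> S}) xs la :
  f (schur_at xs la) = schur_at (map f xs) la.
Proof.
elim: xs la => [|x xs IH] la /=; first by rewrite rmorph_nat.
by rewrite rmorph_sum; apply: eq_bigr => ka _; rewrite rmorphM rmorphXn IH.
Qed.

Lemma schur_at_nil (R : comNzRingType) la :
  schur_at [::] la = (sumn la == 0)%:R :> R.
Proof. by []. Qed.

Lemma schur_at_cons (R : comNzRingType) (x : R) xs la : schur_at (x :: xs) la =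
  \sum_(ka <- inter la) x ^+ (sumn la - sumn ka) * schur_at xs ka.
Proof. by []. Qed.

Section Rows.
Variable R : comNzRingType.
Implicit Type xs : seq R.

(** Trailing zeros are harmless: padding and truncating are inverse bijections between the two lists
    of interlacing sequences. *)
Lemma schur_at_ext xs la la' :
  (forall i, nth 0%N la i = nth 0%N la' i) -> schur_at xs la = schur_at xs la'.
Proof.
elim: xs la la' => [|x xs IH] la la' e; first by rewrite !schur_at_nil (eq_sumn e).
rewrite !schur_at_cons (eq_sumn e).
have nthP (l : seq nat) (ka : seq nat) : interlacing l ka ->
    forall i, nth 0%N (mkseq (nth 0%N ka) (size l)) i = nth 0%N ka i.
  move=> /interlacingP h i; have [lt|ge] := ltnP i (size l).
    by rewrite nth_mkseq.
  have := h i; rewrite (nth_default 0%N ge).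
  by rewrite (@nth_default _ _ (mkseq _ _)) ?size_mkseq //; lia.
have inE (l l' ka : seq nat) : (forall i, nth 0%N l i = nth 0%N l' i) ->
    interlacing l' ka -> mkseq (nth 0%N ka) (size l) \in inter l.
  move=> el hk; have hk' : interlacing l ka.
    by apply/interlacingP => i; rewrite !el; move/interlacingP: hk.
  rewrite mem_inter size_mkseq eqxx; apply/interlacingP => i; rewrite nthP //.
  by move/interlacingP: hk'.
have back (l l' ka : seq nat) : (forall i, nth 0%N l i = nth 0%N l' i) ->
    size ka = size l' -> interlacing l' ka ->
    mkseq (nth 0%N (mkseq (nth 0%N ka) (size l))) (size l') = ka.
  move=> el sz hk; apply: (@eq_from_nth _ 0%N); rewrite size_mkseq ?sz // => i lt.
  rewrite nth_mkseq // nthP //.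
  by apply/interlacingP => j; rewrite !el; move/interlacingP: hk.
rewrite (big_bij (s := inter la') (t := inter la)
  (f := fun ka => mkseq (nth 0%N ka) (size la))
  (g := fun ka => mkseq (nth 0%N ka) (size la'))) ?uniq_inter //.
- apply: eq_big_seq => ka; rewrite mem_inter => /andP[/eqP sz hk].
  have hk' : interlacing la ka.
    by apply/interlacingP => i; rewrite !e; move/interlacingP: hk.
  have en := nthP _ _ hk'.
  by rewrite (eq_sumn en) (IH _ _ en).
- move=> ka; rewrite mem_inter => /andP[/eqP sz hk].
  by split; [exact: inE hk | exact: back].
- move=> ka; rewrite mem_inter => /andP[/eqP sz hk].
  by split; [apply: inE hk | apply: back].
Qed.

Lemma schur_at_row0 xs : schur_at xs [:: 0%N] = 1.
Proof.
elim: xs => [|x xs IH] //.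
by rewrite schur_at_row big_seq1 subnn expr0 mul1r IH.
Qed.

Lemma schur_at_rowS x xs k : schur_at (x :: xs) [:: k.+1] =
  x * schur_at (x :: xs) [:: k] + schur_at xs [:: k.+1].
Proof.
have E : iota 0 k.+2 = iota 0 k.+1 ++ [:: k.+1] by rewrite -(addn1 k.+1) iotaD.
rewrite !schur_at_row E big_cat big_seq1 subnn expr0 mul1r mulr_sumr.
congr (_ + _).
apply: eq_big_seq => b; rewrite (mem_iota 0 k.+1) add0n ltnS => /andP[_ bk].
by rewrite mulrA -exprS subSn.
Qed.

Lemma schur_at_row1 xs : schur_at xs [:: 1%N] = \sum_(x <- xs) x.
Proof.
elim: xs => [|x xs IH]; first by rewrite big_nil.
by rewrite schur_at_rowS schur_at_row0 mulr1 big_cons IH.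
Qed.

Definition power_sum_at k xs : R := \sum_(x <- xs) x ^+ k.

(** Induction on the alphabet and, inside it, on the degree: [schur_at_rowS] reduces the identity to
    the one for [xs] in the same degree and the one for [x :: xs] one degree lower. *)
Lemma newton xs k : k.+1%:R * schur_at xs [:: k.+1] =
  \sum_(i < k.+1) power_sum_at i.+1 xs * schur_at xs [:: (k - i)%N].
Proof.
elim: xs k => [|x xs IH] k.
  by rewrite big1 /= ?mulr0 // => i _; rewrite /power_sum_at big_nil mul0r.
rewrite /power_sum_at.
under eq_bigr => i _ do rewrite big_cons mulrDl -/(power_sum_at i.+1 xs).
elim: k => [|k IHk].
  have := IH 0%N; rewrite !big_ord1 !schur_at_rowS !schur_at_row0.
  by rewrite mulrDr => ->; ring.
rewrite big_split /= [X in X + _]big_ord_recl [X in _ + X]big_ord_recr /=.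
under eq_bigr => i _ do rewrite /bump /= add1n subSS exprS -mulrA.
rewrite -mulr_sumr subnn schur_at_row0 mulr1 subn0.
have -> : \sum_(i < k.+1) power_sum_at i.+1 xs * schur_at (x :: xs) [:: (k.+1 - i)%N]
   = x * (\sum_(i < k.+1) power_sum_at i.+1 xs * schur_at (x :: xs) [:: (k - i)%N])
   + \sum_(i < k.+1) power_sum_at i.+1 xs * schur_at xs [:: (k.+1 - i)%N].
  rewrite mulr_sumr -big_split /=; apply: eq_bigr => i _.
  by rewrite subSn -1?ltnS // schur_at_rowS; ring.
have := IH k.+1; rewrite big_ord_recr /= subnn schur_at_row0 mulr1 => IHk1.
have -> : schur_at (x :: xs) [:: k.+2] =
  x * schur_at (x :: xs) [:: k.+1] + schur_at xs [:: k.+2] by exact: schur_at_rowS.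
move: IHk; rewrite big_split /= => IHk.
set B := \sum_(i < k.+1) _ in IHk *; set A := \sum_(i < k.+1) _ in IHk *.
set S := \sum_(i < k.+1) _ in IHk1 *.
have -> : B = k.+1%:R * schur_at (x :: xs) [:: k.+1] - A by rewrite IHk addrK.
have -> : S = k.+2%:R * schur_at xs [:: k.+2] - power_sum_at k.+2 xs.
  by rewrite IHk1 addrK.
by rewrite -[k.+2%:R]natr1; ring.
Qed.

(** The order suits the head variable: its square, the products without it, the products containing
    it once. For ['X :: map polyC xs] this is ['X^2] followed by [mixed]. *)
Fixpoint pair_products xs : seq R :=
  if xs is x :: xs' then
    x ^+ 2 :: pair_products xs' ++ [seq x * y | y <- xs']
  else [::].

Lemma schur_at_row2_power xs k : schur_at [seq x ^+ k | x <- xs] [:: 2%N] =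
  power_sum_at k (pair_products xs).
Proof.
elim: xs => [|x xs IH]; first by rewrite /power_sum_at big_nil.
rewrite map_cons !schur_at_rowS schur_at_row0 schur_at_row1 IH.
rewrite /power_sum_at /= big_cons big_cat !big_map /= -exprM mulnC exprM.
rewrite mulr1 mulrDr -expr2 -addrA [X in _ + X = _]addrC mulr_sumr.
congr (_ + (_ + _)).
by apply: eq_bigr => y _; rewrite exprMn.
Qed.

End Rows.

(** * Expansions in power sums and in Schur functions *)

(** Reversed so that the last variable, singled out by [muni], is the head that branching splits
    off. *)
Definition vars N : seq {mpoly rat[N]} := rev [tuple 'X_i | i < N].

Lemma schur_comp la N K (t : N.-tuple {mpoly rat[K]}) : sorted geq la ->
  schur la N \mPo t = schur_at (rev t) la.
Proof.
move=> sla; have -> : rev t = rev (mkseq (nth 0 t) N) :> seq _.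
  congr rev; apply: (@eq_from_nth _ 0); rewrite ?size_mkseq ?size_tuple // => i lt.
  by rewrite nth_mkseq.
rewrite -tableau_sumE // /schur rmorph_sum; apply: eq_bigr => T _.
by rewrite rmorph_prod; apply: eq_bigr => c _; rewrite /= comp_mpolyXU.
Qed.

Lemma schurE la N : sorted geq la -> schur la N = schur_at (vars N) la.
Proof. by move=> sla; rewrite -schur_comp // comp_mpoly_id. Qed.

Lemma power_sum_comp k N K (t : N.-tuple {mpoly rat[K]}) :
  powersum k N \mPo t = power_sum_at k t.
Proof.
rewrite /powersum /power_sum_at rmorph_sum big_tuple; apply: eq_bigr => i _.
by rewrite rmorphXn /= comp_mpolyXU -tnth_nth.
Qed.

Lemma power_sum_rev (R : comNzRingType) k (xs : seq R) :
  power_sum_at k (rev xs) = power_sum_at k xs.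
Proof. by apply: perm_big; rewrite perm_rev. Qed.

Lemma powersumE k N : powersum k N = power_sum_at k (vars N).
Proof. by rewrite power_sum_rev -power_sum_comp comp_mpoly_id. Qed.

Lemma comp_mpolyA d e K (P : {mpoly rat[d]}) (a : d.-tuple {mpoly rat[e]})
    (b : e.-tuple {mpoly rat[K]}) :
  (P \mPo a) \mPo b = P \mPo [tuple tnth a i \mPo b | i < d].
Proof.
rewrite [P \mPo a]comp_mpolyEX [RHS]comp_mpolyEX rmorph_sum /=; apply: eq_bigr => m _.
rewrite comp_mpolyZ !comp_mpolyX rmorph_prod /=; congr (_ *: _); apply: eq_bigr => i _.
by rewrite rmorphXn /= tnth_mktuple.
Qed.

Definition row_sf (k : nat) : symfun := fun N => schur_at (vars N) [:: k].

Section Subalgebra.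
Variable A : symfun -> Prop.

(** Applied to two predicates: having an expansion in power sums, and preserving the Schur span
    under multiplication. Inside either, power sums and rows can be exchanged as generators. *)
Definition subalgebra : Prop :=
  [/\ forall c, A (fun N => c%:MP),
      forall f g, A f -> A g -> A (fun N => f N + g N)
    & forall f g, A f -> A g -> A (fun N => f N * g N)].

Lemma symfun_eq (f g : symfun) : (forall N, f N = g N) -> A f -> A g.
Proof.
move=> e; have -> // : f = g.
exact: functional_extensionality_dep.
Qed.

Hypothesis Asub : subalgebra.

Lemma subalgebra_scale c f : A f -> A (fun N => c *: f N).
Proof.
move=> Af; have [AK _ AM] := Asub; apply: symfun_eq (AM _ _ (AK c) Af) => N.
by rewrite mul_mpolyC.
Qed.

Lemma subalgebra_sum I (r : seq I) (F : I -> symfun) :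
  (forall i, A (F i)) -> A (fun N => \sum_(i <- r) F i N).
Proof.
move=> AF; have [AK AD _] := Asub; elim: r => [|i r IH].
  by apply: symfun_eq (AK 0) => N; rewrite big_nil mpolyC0.
by apply: symfun_eq (AD _ _ (AF i) IH) => N; rewrite big_cons.
Qed.

Lemma subalgebra_sum_seq (I : eqType) (r : seq I) (F : I -> symfun) :
  (forall i, i \in r -> A (F i)) -> A (fun N => \sum_(i <- r) F i N).
Proof.
move=> AF; have [AK AD _] := Asub.
have AG i : A (fun N => if i \in r then F i N else 0).
  have [ir|_] := boolP (i \in r); first exact: AF.
  by apply: symfun_eq (AK 0) => N; rewrite mpolyC0.
apply: symfun_eq (subalgebra_sum r AG) => N.
by apply: eq_big_seq => i ->.
Qed.

Lemma subalgebra_prod I (r : seq I) (F : I -> symfun) :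
  (forall i, A (F i)) -> A (fun N => \prod_(i <- r) F i N).
Proof.
move=> AF; have [AK _ AM] := Asub; elim: r => [|i r IH].
  by apply: symfun_eq (AK 1) => N; rewrite big_nil mpolyC1.
by apply: symfun_eq (AM _ _ (AF i) IH) => N; rewrite big_cons.
Qed.

Lemma subalgebra_exp m f : A f -> A (fun N => f N ^+ m).
Proof.
move=> Af; apply: symfun_eq (subalgebra_prod (iota 0 m) (fun=> Af)) => N.
by rewrite big_const_seq count_predT size_iota iter_mulr_1.
Qed.

Lemma subalgebra_comp d (P : {mpoly rat[d]}) (F : 'I_d -> symfun) :
  (forall i, A (F i)) -> A (fun N => P \mPo [tuple F i N | i < d]).
Proof.
move=> AF.
apply: (@symfun_eq (fun N => \sum_(m <- msupp P)
    P@_m *: \prod_(i <- index_enum 'I_d) F i N ^+ m i)) => [N|].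
  rewrite comp_mpolyEX; apply: eq_bigr => m _; rewrite comp_mpolyX; congr (_ *: _).
  by apply: eq_bigr => i _; rewrite tnth_mktuple.
apply: subalgebra_sum => m; apply: subalgebra_scale.
by apply: (@subalgebra_prod _ _ (fun i N => F i N ^+ m i)) => i; apply: subalgebra_exp.
Qed.

(** Newton's identity solved for h_{k+1}; the division by k + 1 uses rational coefficients. *)
Lemma subalgebra_row k : (forall j, A (powersum j.+1)) -> A (row_sf k).
Proof.
move=> Ap; have [AK _ AM] := Asub.
elim/ltn_ind: k => -[|k] IH.
  by apply: symfun_eq (AK 1) => N; rewrite mpolyC1 /row_sf schur_at_row0.
apply: (@symfun_eq (fun N => k.+1%:R^-1 *:
   \sum_(i <- index_enum 'I_k.+1) powersum i.+1 N * row_sf (k - i) N)) => [N|].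
  have := newton (vars N) k; rewrite -/(row_sf k.+1 N).
  under eq_bigr => i _ do rewrite -powersumE -/(row_sf _ N).
  by move=> <-; rewrite mulr_natl -scaler_nat scalerA mulVf ?scale1r // pnatr_eq0.
apply: subalgebra_scale; apply: (@subalgebra_sum _ _ (fun i : 'I_k.+1 => fun N => powersum i.+1 N * row_sf (k - i) N)) => i.
by apply: AM => //; apply: IH; lia.
Qed.

Lemma subalgebra_powersum k : (forall j, A (row_sf j)) -> A (powersum k.+1).
Proof.
move=> Ah; have [AK AD AM] := Asub.
elim/ltn_ind: k => k IH.
apply: (@symfun_eq (fun N => k.+1%:R *: row_sf k.+1 N + (-1) *:
   \sum_(i <- index_enum 'I_k) powersum i.+1 N * row_sf (k - i) N)) => [N|].
  have := newton (vars N) k; rewrite -/(row_sf k.+1 N) big_ord_recr /=.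
  rewrite subnn schur_at_row0 mulr1 -powersumE.
  under eq_bigr => i _ do rewrite -powersumE -/(row_sf _ N).
  by rewrite scaler_nat -[row_sf _ _ *+ _]mulr_natl => ->; rewrite scaleN1r addrAC subrr add0r.
apply: (AD (fun N => _ *: _) (fun N => _ *: _)); first exact: subalgebra_scale.
apply: (@subalgebra_scale (-1) (fun N => \sum_(i <- index_enum 'I_k) powersum i.+1 N * row_sf (k - i) N)).
apply: (@subalgebra_sum _ _ (fun i : 'I_k => fun N => powersum i.+1 N * row_sf (k - i) N)) => i.
by apply: AM => //; apply: IH.
Qed.

(** Pieri's rule is triangular: h_k s_mu is s_(mu,k) plus terms whose entry in the new row is
    smaller than k. Hence the double induction on the number of rows and the last entry. *)
Lemma subalgebra_schur mu : (forall j, A (row_sf j)) -> sorted geq mu ->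
  A (fun N => schur_at (vars N) mu).
Proof.
move=> Ah; have [AK AD AM] := Asub.
elim: {mu}(size mu) {-2}mu (erefl (size mu)) => [|L IHL] mu szmu smu.
  apply: symfun_eq (AK 1) => N; rewrite (@schur_at_ext _ _ _ [:: 0%N]).
    by rewrite schur_at_row0 mpolyC1.
  by case: mu szmu {smu} => // _ [|[|i]].
case/lastP: mu szmu smu => [//|mu k]; rewrite size_rcons => -[].
elim/ltn_ind: k mu => k IH mu szmu smu.
have smu' : sorted geq mu by move: smu; rewrite -cats1 => /cat_sorted2[].
have nthr i : nth 0%N (rcons mu k) i = if i == size mu then k else nth 0%N mu i.
  by rewrite nth_rcons; case: ltngtP => // h; rewrite nth_default // ltnW.
have kin : rcons mu k \in up k mu.
  rewrite mem_up size_rcons eqxx sumn_rcons eqxx; apply/interlacingP => i.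
  rewrite !nthr; move/sorted_geqP: smu => /(_ i); rewrite !nthr.
  move/sorted_geqP: smu' => /(_ i).
  case: (ltngtP i (size mu)) => [h|h|->]; rewrite ?[nth _ mu (size mu)]nth_default //.
  - by case: eqP => h' *; apply/andP; split=> //; lia.
  - rewrite gtn_eqF; last lia. lia.
  - rewrite gtn_eqF // (@nth_default _ _ _ (size mu).+1) //.
apply: (@symfun_eq (fun N => row_sf k N * schur_at (vars N) mu + (-1) *:
   \sum_(la <- up k mu | la != rcons mu k) schur_at (vars N) la)) => [N|].
  rewrite pieri // (bigD1_seq (rcons mu k)) ?uniq_up //=.
  by rewrite scaleN1r addrK.
apply: (AD (fun N => _ * _) (fun N => _ *: _)); first by apply: AM => //; apply: IHL.
apply: (@subalgebra_scale (-1) (fun N => _)).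
apply: (@symfun_eq (fun N => \sum_(la <- [seq la <- up k mu | la != rcons mu k])
   schur_at (vars N) la)) => [N|]; first by rewrite big_filter.
apply: (@subalgebra_sum_seq _ _ (fun la N => schur_at (vars N) la)) => la.
rewrite mem_filter => /andP[ne lai]; have sla := sorted_up smu' lai.
move: lai; rewrite mem_up => /and3P[/eqP szla /eqP sumla /interlacingP h].
case/lastP: la szla sumla h ne sla => [//|la k']; rewrite size_rcons => -[szla].
move=> sumla h ne sla; apply: (IH k') => //; last by rewrite szla.
(* With a last entry of at least k, the shape would contain [rcons mu k] and have the same size,
   hence be equal to it. *)
rewrite ltnNge; apply/negP => le; move/eqP: ne; apply.
apply: esym; apply: (@eq_from_nth _ 0%N); first by rewrite !size_rcons szla.
move=> i _; move: i; apply: sumn_leq_eq; last by rewrite sumla sumn_rcons.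
move=> i; rewrite nthr; case: eqP => [->|_]; last by have := h i; lia.
by rewrite -szla nth_rcons ltnn eqxx.
Qed.

End Subalgebra.

(** * Plethysm with s_(2): evaluation at pair products, membership in the Schur span *)

Lemma widen_powersum_expansion d d' (P : {mpoly rat[d]}) : (d <= d')%N ->
  exists P' : {mpoly rat[d']}, forall N,
    P \mPo [tuple powersum i.+1 N | i < d] =
    P' \mPo [tuple powersum i.+1 N | i < d'].
Proof.
move=> h; exists (P \mPo [tuple 'X_(widen_ord h i) | i < d]) => N.
rewrite comp_mpolyA; congr (_ \mPo _); apply: eq_from_tnth => i.
by rewrite !tnth_mktuple comp_mpolyXU nth_mktuple.
Qed.

Lemma powersum_expands_subalgebra :
  subalgebra (fun f => exists P, powersum_expands f P).
Proof.
have both f g : (exists P, powersum_expands f P) -> (exists P, powersum_expands g P) ->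
    exists d (P Q : {mpoly rat[d]}),
      (forall N, f N = P \mPo [tuple powersum i.+1 N | i < d]) /\
      (forall N, g N = Q \mPo [tuple powersum i.+1 N | i < d]).
  move=> [[d P] fP] [[e Q] gQ]; exists (maxn d e).
  have [P' PE] := widen_powersum_expansion P (leq_maxl d e).
  have [Q' QE] := widen_powersum_expansion Q (leq_maxr d e).
  by exists P', Q'; split=> N; rewrite (fP, gQ) /= (PE, QE).
split=> [c|f g fp gp|f g fp gp].
- by exists (existT _ 0%N c%:MP) => N; rewrite comp_mpolyC.
- have [d [P [Q [fE gE]]]] := both f g fp gp.
  by exists (existT _ d (P + Q)) => N; rewrite fE gE comp_mpolyD.
- have [d [P [Q [fE gE]]]] := both f g fp gp.
  by exists (existT _ d (P * Q)) => N; rewrite fE gE rmorphM.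
Qed.

(** Guarantees that [powersum_expansion] is a genuine expansion here and not the default. *)
Lemma schur_powersum_expands la : sorted geq la ->
  powersum_expands (schur la) (powersum_expansion (schur la)).
Proof.
move=> sla; have [P hP] : exists P, powersum_expands (schur la) P.
  have Ap j : exists P, powersum_expands (powersum j.+1) P.
    exists (existT _ j.+1 'X_ord_max) => N.
    by rewrite comp_mpolyXU nth_mktuple.
  have := subalgebra_schur powersum_expands_subalgebra
    (fun k => subalgebra_row powersum_expands_subalgebra k Ap) sla.
  by move=> [P hP]; exists P => N; rewrite schurE.
exact: (@xgetPex _ _ [set Q | powersum_expands (schur la) Q]%classic (ex_intro _ P hP)).
Qed.

Lemma powersum_plethysm_row2 k N :
  powersum_plethysm k (schur [:: 2%N]) N = power_sum_at k (pair_products (vars N)).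
Proof.
rewrite /powersum_plethysm schur_comp // -schur_at_row2_power; congr (schur_at _ _).
rewrite map_rev; congr rev.
by apply: (@eq_from_nth _ 0) => [|i]; rewrite !size_map ?size_tuple // => lt; rewrite -map_comp.
Qed.

(** The chosen polynomial in the power sums gives [schur nu] in every number of variables, in
    particular in as many as there are pair products. Substituting these turns p_k into p_k at the
    pair products, which is p_k o s_(2). *)
Lemma plethysm_row2E nu N : sorted geq nu ->
  plethysm (schur nu) (schur [:: 2%N]) N = schur_at (pair_products (vars N)) nu.
Proof.
move=> snu; rewrite /plethysm; have := schur_powersum_expands snu.
case: (powersum_expansion _) => d P /= hP.
set Y := pair_products (vars N).
have -> : schur_at Y nu = schur nu _ \mPo in_tuple (rev Y).
  by rewrite schur_comp // revK.
rewrite hP /=.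
rewrite comp_mpolyA; congr (_ \mPo _); apply: eq_from_tnth => i.
by rewrite !tnth_mktuple powersum_plethysm_row2 power_sum_comp power_sum_rev.
Qed.

(** One list serves all [N]. Repetitions and trailing zeros are allowed, so that the closure
    properties are plain list operations. *)
Definition schur_span (f : symfun) : Prop := exists l : seq (rat * seq nat),
  (forall p, p \in l -> sorted geq p.2) /\
  forall N, f N = \sum_(p <- l) p.1 *: schur_at (vars N) p.2.

Lemma schur_span_add f g : schur_span f -> schur_span g ->
  schur_span (fun N => f N + g N).
Proof.
move=> [l [sl fE]] [m [sm gE]]; exists (l ++ m); split=> [p|N].
  by rewrite mem_cat => /orP[/sl|/sm].
by rewrite big_cat fE gE.
Qed.

Lemma schur_span_scale c f : schur_span f -> schur_span (fun N => c *: f N).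
Proof.
move=> [l [sl fE]]; exists [seq (c * p.1, p.2) | p <- l]; split=> [p|N].
  by move=> /mapP[q /sl sq ->].
by rewrite fE scaler_sumr big_map; apply: eq_bigr => p _; rewrite scalerA.
Qed.

Lemma schur_span_row k f : schur_span f ->
  schur_span (fun N => row_sf k N * f N).
Proof.
move=> [l [sl fE]].
exists [seq (p.1, la) | p <- l, la <- up k p.2]; split=> [q|N].
  by move=> /allpairsPdep[p [la [pl lai ->]]]; apply: sorted_up (sl p pl) lai.
rewrite fE big_allpairs_dep mulr_sumr; apply: eq_big_seq => p pl.
by rewrite -scalerAr pieri ?sl // scaler_sumr.
Qed.

(** Pieri's rule covers products with rows only; the multipliers of the span form a subalgebra that
    contains the rows, hence the power sums. *)
Definition schur_multiplier (f : symfun) : Prop :=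
  forall g, schur_span g -> schur_span (fun N => f N * g N).

Lemma schur_multiplier_subalgebra : subalgebra schur_multiplier.
Proof.
split=> [c g gs|f f' fs fs' g gs|f f' fs fs' g gs].
- by apply: symfun_eq (schur_span_scale c gs) => N; rewrite mul_mpolyC.
- by apply: symfun_eq (schur_span_add (fs g gs) (fs' g gs)) => N; rewrite mulrDl.
- by apply: symfun_eq (fs _ (fs' g gs)) => N; rewrite mulrA.
Qed.

Lemma powersum_plethysm_row2_half k N : powersum_plethysm k (schur [:: 2%N]) N =
  2%:R^-1 *: (powersum k N * powersum k N + powersum k.*2 N).
Proof.
rewrite powersum_plethysm_row2 -schur_at_row2_power.
have := newton [seq x ^+ k | x <- vars N] 1.
rewrite big_ord_recr big_ord1 /= subnn schur_at_row0 schur_at_row1 mulr1.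
rewrite /power_sum_at !big_map.
have -> : \sum_(x <- vars N) x ^+ k ^+ 1 = powersum k N.
  by rewrite powersumE; apply: eq_bigr => x _; rewrite expr1.
have -> : \sum_(x <- vars N) x ^+ k ^+ 2 = powersum k.*2 N.
  by rewrite powersumE; apply: eq_bigr => x _; rewrite -exprM muln2.
by move=> <-; rewrite mulr_natl -scaler_nat scalerA mulVf ?scale1r // pnatr_eq0.
Qed.

(** The plethysm is a polynomial in the p_k o s_(2), which are polynomials in power sums and so
    multipliers of the span; it is then applied to 1. *)
Lemma plethysm_row2_schur_span f :
  schur_span (plethysm f (schur [:: 2%N])).
Proof.
have s1 : schur_span (fun N => 1).
  exists [:: (1, [:: 0%N])]; split=> [p|N]; first by rewrite inE => /eqP ->.
  by rewrite big_seq1 scale1r schur_at_row0.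
have MS := schur_multiplier_subalgebra; have [_ MD MM] := MS.
have Mp k : schur_multiplier (powersum k.+1).
  by apply: (subalgebra_powersum MS) => j g; apply: schur_span_row.
have Mq d (i : 'I_d) : schur_multiplier (powersum_plethysm i.+1 (schur [:: 2%N])).
  apply: symfun_eq (subalgebra_scale MS 2%:R^-1 (MD _ _ (MM _ _ (Mp i) (Mp i)) (Mp (i.*2.+1)))).
  by move=> N; rewrite powersum_plethysm_row2_half.
rewrite /plethysm; case: (powersum_expansion _) => d P /=.
have := subalgebra_comp MS P (Mq d) _ s1.
apply: symfun_eq => N.
by rewrite mulr1.
Qed.

(** * Linear independence of Schur functions *)

(** The coefficient of x^j in s_la(x, xs). *)
Definition layer (R : comNzRingType) j la (xs : seq R) : R :=
  \sum_(ka <- inter la | (sumn la - sumn ka == j)%N) schur_at xs ka.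

Lemma coef_schur_at_cons (R : comNzRingType) (xs : seq R) la j :
  (schur_at ('X :: map polyC xs) la)`_j = layer j la xs.
Proof.
rewrite schur_at_cons coef_sum [RHS]big_mkcond; apply: eq_bigr => ka _.
rewrite -(rmorph_schur_at polyC) coefMC coefXn eq_sym.
by case: eqP; rewrite ?mul1r ?mul0r.
Qed.

Lemma sumn_behead s : sumn s = (nth 0 s 0 + sumn (behead s))%N.
Proof. by case: s. Qed.

Lemma sumn_behead_inter la ka : ka \in inter la ->
  (sumn (behead la) <= sumn ka)%N.
Proof.
rewrite mem_inter => /andP[_ /interlacingP h].
by apply: leq_sumn => i; rewrite nth_behead; have := h i; lia.
Qed.

Lemma layer_large (R : comNzRingType) j la (xs : seq R) :
  (nth 0 la 0 < j)%N -> layer j la xs = 0.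
Proof.
move=> h; rewrite /layer big_seq_cond big_pred0 // => ka.
apply/negP => /andP[/sumn_behead_inter h1 /eqP h2].
by have := sumn_behead la; lia.
Qed.

Lemma inter_top a la : sorted geq (a :: la) ->
  perm_eq [seq ka <- inter (a :: la) | (sumn (a :: la) - sumn ka == a)%N]
          [:: rcons la 0%N].
Proof.
move=> sla.
apply: uniq_perm => // [|ka]; first exact/filter_uniq/uniq_inter.
rewrite mem_filter inE; apply/andP/eqP => [[/eqP e ki]|->].
  have := sumn_behead_inter ki; have := sumn_inter ki.
  move: ki; rewrite mem_inter => /andP[/eqP sz /interlacingP h] /= h1 h2.
  apply/esym/(@eq_from_nth _ 0%N); first by rewrite size_rcons sz.
  move=> i _; move: i; apply: sumn_leq_eq; last by rewrite sumn_rcons /= in e *; lia.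
  by move=> i; rewrite nth_rcons0; have := h i; rewrite /=; lia.
rewrite /= sumn_rcons addn0 addnK eqxx mem_inter size_rcons eqxx; split=> //.
apply/interlacingP => i; rewrite nth_rcons0 /= leqnn.
by move/sorted_geqP: sla => /(_ i).
Qed.

Lemma layer_top (R : comNzRingType) la (xs : seq R) : sorted geq la ->
  layer (nth 0%N la 0) la xs = schur_at xs (behead la).
Proof.
case: la => [|a la] sla; first by rewrite /layer big_cons big_nil addr0.
rewrite /layer -big_filter (perm_big _ (inter_top sla)) big_seq1 /=.
exact/schur_at_ext/nth_rcons0.
Qed.

Definition canonical_part (la : seq nat) : bool := sorted geq la && (0%N \notin la).

Lemma is_part_ofE n la :
  is_part_of n la = canonical_part la && (sumn la == n).
Proof. by rewrite /is_part_of /canonical_part andbA. Qed.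

Lemma canonical_behead la : canonical_part la -> canonical_part (behead la).
Proof.
case: la => // a la; rewrite /canonical_part inE negb_or.
by move=> /andP[/path_sorted sla /andP[_ n0]]; apply/andP.
Qed.

Lemma canonical_eq la ka : canonical_part la -> canonical_part ka ->
  (forall i, nth 0%N la i = nth 0%N ka i) -> la = ka.
Proof.
elim: la ka => [|a la IH] [|b ka] //.
- by move=> _ /andP[_ n0] /(_ 0%N) /= e; rewrite inE -e eqxx in n0.
- by move=> /andP[_ n0] _ /(_ 0%N) /= e; rewrite inE e eqxx in n0.
- move=> /canonical_behead cl /canonical_behead ck h.
  by rewrite -[a]/(nth 0 (a :: la) 0)%N h (IH ka) // => i; apply: (h i.+1).
Qed.

(** On weakly decreasing sequences only trailing zeros are dropped, which gives the normal form that
    indexes coefficients. *)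
Definition strip (s : seq nat) : seq nat := [seq x <- s | x != 0%N].

Lemma nth_strip s i : sorted geq s -> nth 0%N (strip s) i = nth 0%N s i.
Proof.
elim: s i => [|a s IH] i //= sas; have ss := path_sorted sas.
case: eqP => [a0|_] /=; last by case: i => //= i; apply: IH.
have := @geq_nth (a :: s) 0 i sas isT; have := @geq_nth (a :: s) 0 i.+1 sas isT.
by rewrite IH // a0 /=; lia.
Qed.

Lemma canonical_strip s : sorted geq s -> canonical_part (strip s).
Proof.
move=> ss; rewrite /canonical_part mem_filter /= andbT.
by apply/sorted_geqP => i; rewrite !nth_strip //; apply/sorted_geqP.
Qed.

Lemma strip_eqP s la : sorted geq s -> canonical_part la ->
  reflect (forall i, nth 0%N s i = nth 0%N la i) (strip s == la).
Proof.
move=> ss cl; apply: (iffP eqP) => [<- i|h]; first by rewrite nth_strip.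
by apply: canonical_eq => // [|i]; rewrite ?canonical_strip // nth_strip.
Qed.

Lemma schur_at_strip (R : comNzRingType) (xs : seq R) s : sorted geq s ->
  schur_at xs (strip s) = schur_at xs s.
Proof. by move=> ss; apply: schur_at_ext => i; apply: nth_strip. Qed.

Lemma muni_widen N (i : 'I_N) :
  muni ('X_(widen_ord (leqnSn N) i) : {mpoly rat[N.+1]}) = ('X_i)%:P.
Proof.
rewrite muniE msuppX big_seq1 mcoeffX eqxx scale1r mnmE.
rewrite (_ : (_ == _) = false); last by apply/negbTE; rewrite -val_eqE /= ltn_eqF.
rewrite expr0 alg_polyC; congr (_%:P); congr ('X_[_]); apply/mnmP => j.
by rewrite !mnmE -!val_eqE.
Qed.

Lemma muni_max N : muni ('X_ord_max : {mpoly rat[N.+1]}) = 'X.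
Proof.
rewrite muniE msuppX big_seq1 mcoeffX eqxx scale1r mnmE eqxx expr1.
rewrite (_ : [multinom _ | i < N] = 0%MM) ?mpolyX0 ?scale1r //.
apply/mnmP => j; rewrite !mnmE.
by rewrite (_ : (_ == _) = false) //; apply/negbTE; rewrite -val_eqE /= gtn_eqF.
Qed.

Lemma muni_vars N : map (@muni N rat) (vars N.+1) = 'X :: map polyC (vars N).
Proof.
have tE n T (F : 'I_n -> T) : [tuple F i | i < n] = map F (enum 'I_n) :> seq T.
  by [].
rewrite /vars !map_rev -rev_rcons !tE enum_ordSr 2!map_rcons.
have -> : muni 'X_ord_max = 'X :> {poly {mpoly rat[N]}} by exact: muni_max.
congr (rev (rcons _ _)); elim: (enum 'I_N) => [//|i s IH].
by rewrite !map_cons IH; congr cons; apply: muni_widen.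
Qed.

Lemma coef_muni_sum N (r : seq (seq nat)) (c : seq nat -> rat) j :
  (muni (\sum_(la <- r) c la *: schur_at (vars N.+1) la))`_j =
  \sum_(la <- r) c la *: layer j la (vars N).
Proof.
rewrite raddf_sum coef_sum; apply: eq_bigr => la _.
rewrite /= muniZ coefZ (rmorph_schur_at (@muni N rat)) muni_vars.
by rewrite coef_schur_at_cons mul_mpolyC.
Qed.

Lemma sum_layer_top (R : comAlgType rat) (xs : seq R) j (r : seq (seq nat)) (c : seq nat -> rat) :
  (forall la, la \in r -> canonical_part la) ->
  (forall la, la \in r -> (j < nth 0 la 0)%N -> c la = 0) ->
  \sum_(la <- r) c la *: layer j la xs =
  \sum_(la <- r | nth 0%N la 0 == j) c la *: schur_at xs (behead la).
Proof.
move=> cr c0; rewrite [RHS]big_mkcond; apply: eq_big_seq => la lar.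
have /andP[sla _] := cr la lar.
case: ltngtP => [h|h|<-]; last by rewrite layer_top.
- by rewrite layer_large // scaler0.
- by rewrite c0 // scale0r.
Qed.

(** Induction on the number of variables and, inside it, from long first rows to short ones: the
    coefficient of x^j is a relation between the s_{la^-} with la_1 = j in one variable fewer. The
    bound on the number of parts excludes Schur functions that vanish. *)
Lemma schur_at_free N (S : seq (seq nat)) (c : seq nat -> rat) : uniq S ->
  (forall la, la \in S -> canonical_part la /\ (size la <= N)%N) ->
  \sum_(la <- S) c la *: schur_at (vars N) la = 0 ->
  forall la, la \in S -> c la = 0.
Proof.
elim: N S c => [|N IH] S c uS cS S0.
  have S1 la : la \in S -> la = [::].
    by move=> /cS[_]; rewrite leqn0 size_eq0 => /eqP.
  move=> la laS; move: S0; rewrite (bigD1_seq la) //= big_seq_cond big1.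
    rewrite (S1 la laS) /vars addr0 (_ : rev _ = [::]); last first.
      by apply/eqP; rewrite -size_eq0 size_rev size_tuple.
    move/(congr1 (mcoeff 0)); rewrite mcoeffZ schur_at_nil mcoeff1 eqxx mulr1.
    by rewrite mcoeff0.
  by move=> ka /andP[/S1 -> /eqP []]; rewrite (S1 la laS).
pose B := \max_(la <- S) nth 0%N la 0.
have SB la : la \in S -> (nth 0 la 0 <= B)%N by move=> laS; apply: (@leq_bigmax_seq _ _ xpredT (fun l => nth 0%N l 0)).
suff H m la : la \in S -> (B - nth 0 la 0 < m)%N -> c la = 0.
  by move=> la laS; apply: (H B.+1 la) => //; lia.
elim: m la => // m IHm la0 la0S hm; set j := nth 0%N la0 0.
have big0 la : la \in S -> (j < nth 0 la 0)%N -> c la = 0.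
  by move=> laS h; apply: IHm => //; have := SB la laS; rewrite /j in h *; lia.
have := coef_muni_sum N S c j; rewrite S0.
have -> : muni (0 : {mpoly rat[N.+1]}) = 0 by exact: muni0.
rewrite coef0 sum_layer_top // => [E|la /cS[]//].
pose S' := [seq la <- S | nth 0%N la 0 == j].
(* Restores the row deleted by [behead]; for j = 0 a partition without zeros is empty. *)
pose back ka := if j == 0%N then [::] else j :: ka.
have backK la : la \in S' -> back (behead la) = la.
  rewrite mem_filter => /andP[/eqP hj laS]; have [cl _] := cS la laS.
  rewrite /back; case: eqP => [j0|jn0]; case: la hj laS cl => [|a la] //= e.
  - by move=> _ /andP[_]; rewrite inE e j0.
  - by rewrite /= in e; rewrite -e in jn0.
  - by rewrite e.
have la0S' : la0 \in S' by rewrite mem_filter eqxx.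
rewrite -(backK la0 la0S'); apply: (IH (map behead S') (c \o back)).
- by rewrite map_inj_in_uniq ?filter_uniq // => x y xS yS e; rewrite -(backK x xS) e backK.
- move=> ka /mapP[la]; rewrite mem_filter => /andP[_ /cS[cl sz]] ->.
  by rewrite canonical_behead // size_behead; lia.
- rewrite big_map [RHS]E -[RHS]big_filter; apply: eq_big_seq => la laS'.
  by rewrite /= backK.
- by apply/mapP; exists la0.
Qed.

Lemma group_strip (V : lmodType rat) (l : seq (rat * seq nat)) (S : seq (seq nat))
    (F : seq nat -> V) : uniq S -> (forall p, p \in l -> strip p.2 \in S) ->
  \sum_(p <- l) p.1 *: F (strip p.2) =
  \sum_(la <- S) (\sum_(p <- l | strip p.2 == la) p.1) *: F la.
Proof.
move=> uS lS.
under [RHS]eq_bigr => la _ do rewrite scaler_suml.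
rewrite (exchange_big_dep xpredT) //=; apply: eq_big_seq => p /lS pS.
under eq_bigl => la do rewrite eq_sym.
by rewrite -big_filter filter_pred1_uniq // big_seq1.
Qed.

Lemma schur_at_list_free (l : seq (rat * seq nat)) :
  (forall p, p \in l -> sorted geq p.2) ->
  (forall N, \sum_(p <- l) p.1 *: schur_at (vars N) p.2 = 0) ->
  forall la, \sum_(p <- l | strip p.2 == la) p.1 = 0.
Proof.
move=> sl l0 la; pose S := undup [seq strip p.2 | p <- l].
have lS p : p \in l -> strip p.2 \in S.
  by move=> pl; rewrite mem_undup; apply/mapP; exists p.
have [laS|laS] := boolP (la \in S); last first.
  rewrite big_seq_cond big_pred0 // => p; apply/negP => /andP[/lS pS /eqP e].
  by rewrite -e pS in laS.
pose N := \max_(ka <- S) size ka.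
apply: (@schur_at_free N S (fun la => \sum_(p <- l | strip p.2 == la) p.1)) laS.
- exact: undup_uniq.
- move=> ka kaS; split; last exact: (@leq_bigmax_seq _ _ xpredT size).
  by move: kaS; rewrite mem_undup => /mapP[p pl ->]; apply/canonical_strip/sl.
- rewrite -group_strip ?undup_uniq // -[RHS](l0 N).
  by apply: eq_big_seq => p pl; rewrite schur_at_strip ?sl.
Qed.

(** * Schur expansions with finite support and the Hall product *)

Lemma fsfun_sum (V : lmodType rat) (c : {fsfun seq nat -> rat with 0})
    (S : seq (seq nat)) (F : seq nat -> V) :
  uniq S -> {subset finsupp c <= S} ->
  \sum_(la <- finsupp c) c la *: F la = \sum_(la <- S) c la *: F la.
Proof.
move=> uS sub; rewrite [RHS](bigID (fun la => la \in finsupp c)) /=.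
rewrite [X in _ + X]big1 ?addr0 => [|la ln]; last by rewrite fsfun_dflt ?scale0r.
rewrite -[RHS]big_filter; apply: perm_big; apply: uniq_perm.
- exact: fset_uniq.
- exact: filter_uniq.
- move=> la; rewrite mem_filter; case: (boolP (la \in finsupp c)) => //= h.
  by rewrite sub.
Qed.

Lemma schur_expandsE f c : schur_expands f c ->
  (forall la, la \in finsupp c -> canonical_part la) /\
  forall N, f N = \sum_(la <- finsupp c) c la *: schur_at (vars N) la.
Proof.
move=> [cp fE]; have cc la : la \in finsupp c -> canonical_part la.
  by move=> /cp; rewrite is_part_ofE => /andP[].
split=> // N; rewrite fE; apply: eq_big_seq => la /cc /andP[sla _].
by rewrite schurE.
Qed.

Lemma schur_expands_unique f c c' :
  schur_expands f c -> schur_expands f c' -> c = c'.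
Proof.
move=> /schur_expandsE[cp fE] /schur_expandsE[cp' fE'].
pose S := undup (finsupp c ++ finsupp c').
have uS : uniq S by exact: undup_uniq.
have sub : {subset finsupp c <= S} by move=> la h; rewrite mem_undup mem_cat h.
have sub' : {subset finsupp c' <= S} by move=> la h; rewrite mem_undup mem_cat h orbT.
pose N := \max_(ka <- S) size ka.
have E la : la \in S -> c la - c' la = 0.
  apply: (@schur_at_free N S (fun la => c la - c' la)) => //.
    move=> ka kaS; split; last exact: (@leq_bigmax_seq _ _ xpredT size).
    by move: kaS; rewrite mem_undup mem_cat => /orP[/cp|/cp'].
  under eq_bigr => ka _ do rewrite scalerBl.
  rewrite sumrB -(fsfun_sum _ uS sub) -(fsfun_sum _ uS sub').
  by rewrite -fE -fE' subrr.
apply/fsfunP => la; have [laS|laS] := boolP (la \in S).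
  by apply/eqP; rewrite -subr_eq0 E.
by rewrite !fsfun_dflt //; apply: contra laS; [apply: sub' | apply: sub].
Qed.

Lemma schur_expansionE f c : schur_expands f c -> schur_expansion f = c.
Proof.
move=> h; apply: (schur_expands_unique (f := f)) => //.
exact: (@xgetPex _ _ [set d | schur_expands f d]%classic (ex_intro _ c h)).
Qed.

Lemma schur_span_expands f : schur_span f -> exists c, schur_expands f c.
Proof.
move=> [l [sl fE]]; pose S := undup [seq strip p.2 | p <- l].
have uS : uniq S by exact: undup_uniq.
have lS p : p \in l -> strip p.2 \in S.
  by move=> pl; rewrite mem_undup; apply/mapP; exists p.
have cS la : la \in S -> canonical_part la.
  by rewrite mem_undup => /mapP[p pl ->]; apply/canonical_strip/sl.
pose c : {fsfun seq nat -> rat with 0} :=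
  [fsfun la in [fset x | x in S]%fset => \sum_(p <- l | strip p.2 == la) p.1].
have sub : {subset finsupp c <= S}.
  move=> la; rewrite mem_finsupp fsfunE; case: ifP; last by rewrite eqxx.
  by rewrite !inE.
have cE la : la \in S -> c la = \sum_(p <- l | strip p.2 == la) p.1.
  by move=> laS; rewrite fsfunE !inE laS.
exists c; split=> [la /sub/cS|N].
  by rewrite is_part_ofE eqxx andbT.
rewrite (fsfun_sum _ uS sub) fE.
transitivity (\sum_(la <- S) (\sum_(p <- l | strip p.2 == la) p.1) *: schur_at (vars N) la).
  rewrite -group_strip //; apply: eq_big_seq => p pl.
  by rewrite schur_at_strip ?sl.
by apply: eq_big_seq => la laS; rewrite cE // schurE //; case/andP: (cS la laS).
Qed.

Lemma hall_schur f c la : schur_expands f c -> canonical_part la ->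
  hall f (schur la) = c la.
Proof.
move=> fc cla; pose d : {fsfun seq nat -> rat with 0} :=
  [fsfun ka in [fset la]%fset => 1].
have dE ka : d ka = (ka == la)%:R by rewrite fsfunE inE; case: eqP.
have fd : finsupp d = [fset la]%fset.
  by apply/fsetP => ka; rewrite mem_finsupp dE inE pnatr_eq0 eqb0 negbK.
have hd : schur_expands (schur la) d.
  split=> [ka|N]; rewrite fd; last by rewrite big_seq_fset1 dE eqxx scale1r.
  by rewrite inE is_part_ofE eqxx andbT => /eqP ->.
rewrite /hall (schur_expansionE fc) (schur_expansionE hd).
have [h|h] := boolP (la \in finsupp c).
  rewrite (bigD1_seq la) ?fset_uniq //= dE eqxx mulr1 big1 ?addr0 // => ka /negbTE ne.
  by rewrite dE ne mulr0.
rewrite big_seq big1 ?fsfun_dflt // => ka kac; rewrite dE.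
by case: eqP => [e|_]; rewrite ?mulr0 //; rewrite -e kac in h.
Qed.

(** Deleting the first row is injective on partitions with first row j > 0, so independence of the
    Schur functions of the remaining rows isolates each coefficient. *)
Lemma coef_cons (c : {fsfun seq nat -> rat with 0}) j (K : seq (rat * seq nat)) :
  (forall la, la \in finsupp c -> canonical_part la) ->
  (0 < j)%N ->
  (forall p, p \in K -> sorted geq p.2) ->
  (forall N, \sum_(la <- finsupp c | nth 0%N la 0 == j)
      c la *: schur_at (vars N) (behead la) =
    \sum_(p <- K) p.1 *: schur_at (vars N) p.2) ->
  forall ka, canonical_part ka ->
  c (j :: ka) = \sum_(p <- K | strip p.2 == ka) p.1.
Proof.
move=> cc j0 sK E ka cka.
pose r := [seq la <- finsupp c | nth 0%N la 0 == j].
have := @schur_at_list_free ([seq (c la, behead la) | la <- r] ++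
  [seq (- p.1, p.2) | p <- K]).
have sl p : p \in [seq (c la, behead la) | la <- r] ++ [seq (- p.1, p.2) | p <- K] ->
    sorted geq p.2.
  rewrite mem_cat => /orP[/mapP[la]|/mapP[q qK ->]]; last exact: sK qK.
  by rewrite mem_filter => /andP[_ /cc/canonical_behead cb] ->; case/andP: cb.
move=> /(_ sl _ ka); rewrite big_cat !big_map /= sumrN => H.
have {}H : \sum_(la <- r | strip (behead la) == ka) c la -
    \sum_(p <- K | strip p.2 == ka) p.1 = 0.
  apply: H => N; rewrite big_cat !big_map /= big_filter E.
  by under [X in _ + X]eq_bigr => p _ do rewrite scaleNr; rewrite sumrN subrr.
rewrite -(subr0_eq H) big_filter_cond.
rewrite big_seq_cond (eq_bigl (fun la => (la \in finsupp c) && (la == j :: ka))) => [|la].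
  rewrite -big_seq_cond; have [h|h] := boolP (j :: ka \in finsupp c).
    by rewrite -big_filter filter_pred1_uniq ?fset_uniq // big_seq1.
  rewrite fsfun_dflt // big_seq_cond big_pred0 // => la.
  by apply/negP => /andP[lac /eqP e]; rewrite -e lac in h.
case: (boolP (la \in finsupp c)) => //= /cc cla.
have -> : strip (behead la) = behead la.
  have cb := canonical_behead cla; have /andP[sb _] := cb.
  by apply/eqP/strip_eqP.
case: la cla => [|a la] _ //=; first by rewrite eq_sym (gtn_eqF j0).
Qed.

(** * Top coefficients in one variable *)

Lemma schur_at_scale (R : comNzRingType) (a : R) xs mu :
  schur_at [seq a * x | x <- xs] mu = a ^+ sumn mu * schur_at xs mu.
Proof.
elim: xs mu => [|x xs IH] mu.
  by rewrite !schur_at_nil; case: eqP => [->|]; rewrite ?mulr1 ?mulr0.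
rewrite map_cons !schur_at_cons mulr_sumr; apply: eq_big_seq => ka ki.
by rewrite IH exprMn mulrACA -exprD subnK ?(sumn_inter ki).
Qed.

Lemma inter_refl mu : sorted geq mu -> mu \in inter mu.
Proof.
move=> /sorted_geqP s; rewrite mem_inter eqxx; apply/interlacingP => i.
by rewrite s leqnn.
Qed.

Lemma inter_sumn_eq mu ka : ka \in inter mu -> (sumn mu <= sumn ka)%N -> ka = mu.
Proof.
rewrite mem_inter => /andP[/eqP sz /interlacingP h] le.
apply: (@eq_from_nth _ 0%N) => // i _; move: i; apply: sumn_leq_eq => // i.
by have := h i; lia.
Qed.

Section MixedAlphabet.
Variable R : comNzRingType.
Variable xs : seq R.

(** The pair products other than ['X^2], by degree in ['X]. [W] is independent of [xs], to allow
    induction on its letters. *)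
Definition mixed (W : seq R) : seq {poly R} :=
  map polyC W ++ [seq 'X * x | x <- map polyC xs].

Lemma mixed_nil mu : schur_at (mixed [::]) mu = 'X^(sumn mu) * (schur_at xs mu)%:P.
Proof. by rewrite schur_at_scale -(rmorph_schur_at polyC). Qed.

Lemma mixed_cons w W mu d : (schur_at (mixed (w :: W)) mu)`_d =
  \sum_(ka <- inter mu) w ^+ (sumn mu - sumn ka) * (schur_at (mixed W) ka)`_d.
Proof.
rewrite /mixed map_cons cat_cons schur_at_cons coef_sum.
by apply: eq_bigr => ka _; rewrite -rmorphXn coefCM.
Qed.

Lemma mixed_large W mu d : (sumn mu < d)%N -> (schur_at (mixed W) mu)`_d = 0.
Proof.
elim: W mu => [|w W IH] mu h.
  by rewrite mixed_nil coefMC coefXn gtn_eqF ?mul0r.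
rewrite mixed_cons big_seq big1 // => ka ki; rewrite IH ?mulr0 //.
exact: leq_ltn_trans (sumn_inter ki) h.
Qed.

Lemma mixed_top W mu : sorted geq mu ->
  (schur_at (mixed W) mu)`_(sumn mu) = schur_at xs mu.
Proof.
elim: W mu => [|w W IH] mu smu.
  by rewrite mixed_nil coefMC coefXn eqxx mul1r.
rewrite mixed_cons (bigD1_seq mu) ?uniq_inter ?inter_refl //= subnn mul1r IH //.
rewrite big_seq_cond big1 ?addr0 // => ka /andP[ki ne].
rewrite mixed_large ?mulr0 // ltnNge; apply/negP => /(inter_sumn_eq ki) e.
by rewrite e eqxx in ne.
Qed.

(** Exactly one cell carries a letter of [W]. These letters are the larger ones, so the cell is a
    corner of [mu] and any letter of [W] fits. *)
Lemma mixed_subtop W mu d : sorted geq mu -> sumn mu = d.+1 ->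
  (schur_at (mixed W) mu)`_d =
  (\sum_(w <- W) w) * \sum_(ka <- inter mu | sumn ka == d) schur_at xs ka.
Proof.
elim: W mu => [|w W IH] mu smu sd.
  by rewrite mixed_nil coefMC coefXn sd ltn_eqF // big_nil !mul0r.
rewrite mixed_cons big_cons mulrDl -(IH mu) // [X in w * X]big_mkcond mulr_sumr.
rewrite (bigD1_seq mu) ?uniq_inter ?inter_refl //= subnn mul1r addrC.
congr (_ + _).
rewrite [RHS](bigD1_seq mu) ?uniq_inter ?inter_refl //= sd gtn_eqF // mulr0 add0r.
rewrite big_seq_cond [RHS]big_seq_cond; apply: eq_bigr => ka /andP[ki ne].
have le := sumn_inter ki.
case: eqP => [e|ned]; first by rewrite -e mixed_top ?(sorted_inter ki) // e subSnn expr1.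
rewrite mixed_large ?mulr0 // ltn_neqAle; move/eqP: ned => -> /=.
rewrite -ltnS -sd ltn_neqAle le andbT.
by apply: contra ne => /eqP e; rewrite (inter_sumn_eq ki) ?e.
Qed.

Lemma square_mixed W nu j : (schur_at ('X^2 :: mixed W) nu)`_j =
  \sum_(mu <- inter nu) (if (j < 2 * (sumn nu - sumn mu))%N then 0 else
     (schur_at (mixed W) mu)`_(j - 2 * (sumn nu - sumn mu))).
Proof.
rewrite schur_at_cons coef_sum; apply: eq_bigr => mu _.
by rewrite -exprM coefXnM.
Qed.

Lemma inter_head nu mu : mu \in inter nu ->
  (sumn nu <= sumn mu + nth 0 nu 0)%N.
Proof. by move=> /sumn_behead_inter; rewrite [sumn nu]sumn_behead; lia. Qed.

(** With t cells filled with x^2 and n - t cells of degree at most 1, the degree is at most n + t;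
    the t cells form a horizontal strip, so t <= nu_1. *)
Lemma square_mixed_large W nu j : (sumn nu + nth 0 nu 0 < j)%N ->
  (schur_at ('X^2 :: mixed W) nu)`_j = 0.
Proof.
move=> h; rewrite square_mixed big_seq big1 // => mu mi.
case: ltnP => // le; apply: mixed_large.
have := inter_head mi; have := sumn_inter mi; lia.
Qed.

Lemma square_mixed_top W nu : sorted geq nu ->
  (schur_at ('X^2 :: mixed W) nu)`_(sumn nu + nth 0%N nu 0) =
  schur_at xs (behead nu).
Proof.
move=> snu; rewrite square_mixed -layer_top // /layer [RHS]big_mkcond.
apply: eq_big_seq => mu mi.
have h1 := inter_head mi; have h2 := sumn_inter mi; have := nth_leq_sumn nu 0.
move=> h3; rewrite ltnNge (_ : (_ <= _)%N) /=; last by lia.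
case: eqP => [e|ne]; last by apply: mixed_large; lia.
rewrite (_ : (_ - _)%N = sumn mu); last by lia.
by rewrite mixed_top // (sorted_inter mi).
Qed.

(** Degree n + v - 1 arises in two ways: v - 1 cells with x^2 and all others linear in x, or v cells
    with x^2 and exactly one other cell free of x. *)
Lemma square_mixed_subtop W nu j : sorted geq nu -> (0 < nth 0 nu 1)%N ->
  j.+1 = (sumn nu + nth 0 nu 0)%N ->
  (schur_at ('X^2 :: mixed W) nu)`_j =
  layer (nth 0 nu 0).-1 nu xs + (\sum_(w <- W) w) *
    \sum_(rho <- inter (rcons (behead nu) 0%N) |
          (sumn rho).+1 == sumn (behead nu)) schur_at xs rho.
Proof.
case: nu => // v nu snu nu1 jE; rewrite /= in jE nu1 *.
have nu0 : (0 < sumn nu)%N by apply: leq_trans nu1 (nth_leq_sumn _ _).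
have v0 : (0 < v)%N by have := @geq_nth _ 0 1 snu isT; rewrite /=; lia.
rewrite square_mixed /=.
rewrite (bigID (fun mu => (sumn (v :: nu) - sumn mu == v)%N)) /= addrC.
congr (_ + _).
  rewrite /layer big_mkcond [RHS]big_mkcond; apply: eq_big_seq => mu mi.
  have h1 := inter_head mi; have h2 := sumn_inter mi; rewrite /= in h1 h2.
  case: eqP => /= e1; first by case: eqP => // e2; lia.
  rewrite ltnNge (_ : (_ <= _)%N) /=; last by lia.
  case: eqP => [e|ne]; last by apply: mixed_large; lia.
  rewrite (_ : (_ - _)%N = sumn mu); last by lia.
  by rewrite mixed_top // (sorted_inter mi).
rewrite -big_filter (perm_big _ (inter_top snu)) big_seq1 sumn_rcons addn0.
rewrite ltnNge (_ : (_ <= _)%N) /=; last by lia.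
have srcons : sorted geq (rcons nu 0%N).
  apply: (@sorted_inter (v :: nu)); have := mem_head (rcons nu 0%N) [::].
  by rewrite -(perm_mem (inter_top snu)) mem_filter => /andP[].
rewrite (_ : (_ - _)%N = (sumn nu).-1); last by lia.
rewrite (@mixed_subtop W _ (sumn nu).-1) //; last by rewrite sumn_rcons addn0 prednK.
by congr (_ * _); apply: eq_bigl => rho; rewrite -eqSS prednK.
Qed.

End MixedAlphabet.

Lemma map_pair_products (R S : comNzRingType) (f : {rmorphism R -> S}) xs :
  map f (pair_products xs) = pair_products (map f xs).
Proof.
elim: xs => //= x xs IH; rewrite map_cat IH rmorphXn; congr (_ :: _ ++ _).
by rewrite -!map_comp; apply: eq_map => y /=; rewrite rmorphM.
Qed.

(** Here [nu] stands for nu^-. Both layers run over interlacing sequences of size |nu| + 1, and only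
    the bound on the first entry differs. A first entry above v makes the sequence at least
    [v.+1 :: rcons (behead nu) 0] entrywise, and the sizes agree. *)
Lemma layer_bar (R : comNzRingType) (xs : seq R) v nu : sorted geq (v :: nu) ->
  nth 0%N nu 0 = v -> (0 < v)%N ->
  let n := (v + sumn nu)%N in
  layer (n + v).-1 ((n + v)%N :: nu) xs =
  layer v.-1 (v :: nu) xs + schur_at xs (v.+1 :: rcons (behead nu) 0%N).
Proof.
move=> snu nu0 v0 n.
pose s a := [seq ka <- inter (a :: nu) | sumn ka == (sumn nu).+1].
have layerE a j : (a + sumn nu = j + (sumn nu).+1)%N ->
    layer j (a :: nu) xs = \sum_(ka <- s a) schur_at xs ka.
  move=> e; rewrite big_filter /layer [LHS]big_seq_cond [RHS]big_seq_cond.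
  apply: eq_bigl => ka; case: (boolP (ka \in _)) => //= ki.
  by have := sumn_inter ki; rewrite /=; lia.
pose y := v.+1 :: rcons (behead nu) 0%N; rewrite -/y.
have nthy i : nth 0%N y i = if i == 0%N then v.+1 else nth 0%N nu i.
  case: i => //= i; rewrite nth_rcons nth_behead size_behead.
  case: ltngtP => // h; rewrite nth_default //; move: (size nu) h; case=> //=.
  - by move=> *; lia.
  - by move=> m ->.
have sumy : sumn y = (sumn nu).+1.
  by rewrite /= sumn_rcons addn0 (sumn_behead nu) nu0.
have [szy snuP] : size y = (size nu).+1 /\ (forall i, nth 0 nu i.+1 <= nth 0 nu i)%N.
  split; last by apply/sorted_geqP; apply: path_sorted snu.
  by rewrite /= size_rcons size_behead prednK //; case: (nu) nu0 v0 => //= <-.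
have memS a ka : (ka \in s a) = (sumn ka == (sumn nu).+1) && (ka \in inter (a :: nu)).
  by rewrite mem_filter.
have memE (ka : seq nat) : (ka \in s (n + v)%N) = (ka \in y :: s v).
  rewrite in_cons !memS !mem_inter.
  case: (sumn ka =P _) => [e|ne]; last first.
    by rewrite /= orbF; apply/esym/eqP => e; rewrite e sumy in ne.
  apply/idP/idP => /=.
    move=> /andP[/eqP sz /interlacingP h].
    have [le|lt] := leqP (nth 0%N ka 0) v.
      apply/orP; right; rewrite sz eqxx; apply/interlacingP => -[|i].
        by have := h 0%N; rewrite /= nu0; lia.
      exact: h i.+1.
    apply/orP; left; rewrite eq_sym; apply/eqP.
    apply: (@eq_from_nth _ 0%N); first by rewrite szy sz.
    move=> i _; move: i; apply: sumn_leq_eq; last by rewrite sumy e.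
    by move=> i; rewrite nthy; case: eqP => [->//|_]; have := h i; case: i => //= i; lia.
  case/orP => [/eqP ->|/andP[sz /interlacingP h]].
    rewrite szy eqxx; apply/interlacingP => i; rewrite nthy.
    case: i => [|i] /=; first by rewrite nu0; lia.
    by rewrite snuP leqnn.
  rewrite sz; apply/interlacingP => -[|i]; last exact: h i.+1.
  by have := h 0%N; rewrite /=; lia.
rewrite (layerE (n + v)%N) ?(layerE v); try by rewrite /n; lia.
rewrite (perm_big (y :: s v)) /=; first by rewrite big_cons addrC.
apply: uniq_perm; first exact/filter_uniq/uniq_inter.
  rewrite /= filter_uniq ?uniq_inter // andbT mem_filter mem_inter.
  apply/negP => /and3P[_ _ /interlacingP/(_ 0%N)]; rewrite /=; lia.
exact: memE.
Qed.

(** * Coefficients of the plethysm at the longest first rows *)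

Section Coefficients.
Variables (nu : seq nat) (c : {fsfun seq nat -> rat with 0}).
Hypothesis nu_part : canonical_part nu.
Hypothesis nu_pos : (0 < nth 0 nu 0)%N.
Hypothesis nu_rows : nth 0%N nu 0 = nth 0%N nu 1.
Hypothesis c_expands :
  schur_expands (plethysm (schur nu) (schur [:: 2%N])) c.

Let n := sumn nu.
Let v := nth 0%N nu 0.

Let c_part la : la \in finsupp c -> canonical_part la.
Proof. by have [cc _] := schur_expandsE c_expands; apply: cc. Qed.

Let nv_pos : (0 < n + v)%N. Proof. by rewrite addn_gt0 nu_pos orbT. Qed.

Let nu_sorted : sorted geq nu. Proof. by case/andP: nu_part. Qed.

Lemma sum_layer N j : \sum_(la <- finsupp c) c la *: layer j la (vars N) =
  (schur_at ('X^2 :: mixed (vars N) (pair_products (vars N))) nu)`_j.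
Proof.
rewrite -coef_muni_sum; have [_ <-] := schur_expandsE c_expands.
rewrite (plethysm_row2E _ nu_sorted) (rmorph_schur_at (@muni N rat)).
rewrite (map_pair_products (@muni N rat)) muni_vars /=.
by rewrite /mixed (map_pair_products (@polyC _)).
Qed.

Lemma coef_first_row_large la : (n + v < nth 0 la 0)%N -> c la = 0.
Proof.
pose B := \max_(ka <- finsupp c) nth 0%N ka 0.
have cB ka : ka \in finsupp c -> (nth 0 ka 0 <= B)%N.
  by move=> h; apply: (@leq_bigmax_seq _ _ xpredT (fun l => nth 0%N l 0)).
have [m] : exists m, (B - nth 0 la 0 < m)%N by exists (B - nth 0 la 0).+1.
(* Induction on the distance to the longest first row in the support. *)
elim: m la => // m IH la hm h.
have [lac|] := boolP (la \in finsupp c); last exact: fsfun_dflt.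
have -> : la = nth 0%N la 0 :: behead la by case: (la) h.
rewrite (coef_cons (K := [::]) c_part) ?big_nil //.
- by lia.
- move=> N; rewrite big_nil -sum_layer_top; [|exact: c_part|].
    by rewrite sum_layer square_mixed_large.
  by move=> ka kac hk; apply: IH; have := cB ka kac; lia.
- exact/canonical_behead/c_part.
Qed.

Lemma coef_first_row_top ka : canonical_part ka ->
  c ((n + v)%N :: ka) = (ka == behead nu)%:R.
Proof.
move=> cka; have cb := canonical_behead nu_part; have /andP[sb _] := cb.
rewrite (coef_cons (K := [:: (1, behead nu)]) c_part) //.
- rewrite big_cons big_nil /= addr0; have /eqP -> : strip (behead nu) == behead nu.
    exact/strip_eqP.
  by rewrite eq_sym; case: eqP.
- by move=> p; rewrite inE => /eqP ->.
- move=> N; rewrite big_seq1 scale1r -sum_layer_top; [|exact: c_part|].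
    by rewrite sum_layer square_mixed_top.
  by move=> la _; apply: coef_first_row_large.
Qed.

Definition removals : seq (seq nat) :=
  [seq rho <- inter (rcons (behead nu) 0%N) | (sumn rho).+1 == sumn (behead nu)].

(** Among the partitions with first row at least n + v only bar nu occurs, with coefficient 1, so it
    gives the only correction. *)
Lemma sum_layer_bar N :
  \sum_(la <- finsupp c) c la *: layer (n + v).-1 la (vars N) =
  \sum_(la <- finsupp c | nth 0%N la 0 == (n + v).-1)
     c la *: schur_at (vars N) (behead la) +
  layer (n + v).-1 ((n + v)%N :: behead nu) (vars N).
Proof.
pose bnu := (n + v)%N :: behead nu.
have cb1 : c bnu = 1 by rewrite coef_first_row_top ?canonical_behead ?eqxx.
have bc : bnu \in finsupp c by rewrite mem_finsupp cb1 oner_eq0.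
rewrite (bigD1_seq bnu) ?fset_uniq //= cb1 scale1r addrC; congr (_ + _).
rewrite big_mkcond [RHS]big_mkcond; apply: eq_big_seq => la lac.
have cla := c_part lac; have /andP[sla _] := cla.
case: eqP => [->|/eqP ne] /=; first by rewrite gtn_eqF // prednK.
case: eqP => [e|ne']; first by rewrite -{1}e layer_top.
have [h|h] := ltnP (nth 0%N la 0) (n + v).-1; first by rewrite layer_large ?scaler0.
have [h'|h'] := ltnP (n + v) (nth 0%N la 0).
  by rewrite coef_first_row_large ?scale0r.
have e : nth 0%N la 0 = (n + v)%N by lia.
have laE : la = (n + v)%N :: behead la.
  by rewrite -e; case: (la) e => //= e0; move: nv_pos; rewrite -e0.
rewrite laE coef_first_row_top ?canonical_behead //.
case: eqP => [e'|]; last by rewrite scale0r.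
by rewrite laE e' eqxx in ne.
Qed.

Lemma coef_first_row_subtop ka : canonical_part ka ->
  c ((n + v).-1 :: ka) =
  (\sum_(rho <- removals) count (fun tau => strip tau == ka) (up 2 rho))%:R -
  (strip (v.+1 :: rcons (drop 2 nu) 0%N) == ka)%:R.
Proof.
move=> cka; set y := v.+1 :: _.
pose K := (-1 : rat, y) :: [seq (1, tau) | rho <- removals, tau <- up 2 rho].
have nuE : nu = v :: behead nu by rewrite /v; case: (nu) nu_pos.
have nuE' : behead (behead nu) = drop 2 nu by rewrite -drop1 -drop1 drop_drop.
have snu := nu_sorted; rewrite nuE in snu.
have nu0 : nth 0%N (behead nu) 0 = v by rewrite nth_behead -nu_rows.
have sl := @layer_bar _ _ v (behead nu) snu nu0 nu_pos.
rewrite (coef_cons (K := K) c_part) //.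
- rewrite /K big_mkcond big_cons big_allpairs_dep /= natr_sum addrC.
  congr (_ + _); last by case: eqP => _; rewrite ?oppr0.
  apply: eq_bigr => rho _.
  by rewrite -big_mkcond big_const_seq iter_addr_0.
- by have := nth_leq_sumn nu 0; rewrite /n /v; lia.
- move=> p; rewrite inE => /orP[/eqP ->|/allpairsPdep[rho [tau [ri ti ->]]]].
    apply/sorted_geqP => i; rewrite /y /= nth_rcons0 nth_drop.
    move/sorted_geqP: nu_sorted => snu'.
    case: i => [|i] /=; last by rewrite nth_rcons0 nth_drop; apply: snu'.
    by rewrite (leq_trans (snu' 1%N)) // -nu_rows leqnSn.
  by apply: sorted_up ti; move: ri; rewrite mem_filter => /andP[_ /sorted_inter].
- move=> N; have := sum_layer N (n + v).-1; rewrite sum_layer_bar.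
  rewrite square_mixed_subtop // ?prednK -?nu_rows //.
  have -> : layer v.-1 nu (vars N) = layer v.-1 (v :: behead nu) (vars N).
    by rewrite -nuE.
  have -> : n = (v + sumn (behead nu))%N by rewrite /n {1}nuE.
  (* By [sl] the layer of bar nu contains layer v - 1 of [nu], which cancels against the other side;
     s_y remains and receives the sign -1. *)
  rewrite sl nuE' -/y addrCA => /addrI E.
  rewrite /K big_cons big_allpairs_dep /=.
  apply: (addIr (schur_at (vars N) y)); rewrite E addrAC scaleN1r addNr add0r.
  have -> : \sum_(w <- pair_products (vars N)) w = schur_at (vars N) [:: 2%N].
    have := schur_at_row2_power (vars N) 1.
    by rewrite (eq_map (fun x => expr1 x)) map_id /power_sum_at => ->.
  rewrite mulr_sumr -[LHS]big_filter; apply: eq_big_seq => rho.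
  rewrite mem_filter => /andP[_ /sorted_inter srho]; rewrite pieri //.
  by apply: eq_bigr => tau _; rewrite scale1r.
Qed.

End Coefficients.

(** * Counting strips *)

(** The only candidate is [ka] padded to length [(size rho).+1]; interlacing leaves no room for
    further parts. *)
Lemma count_up_strip k rho ka : sorted geq rho -> canonical_part ka ->
  count (fun tau => strip tau == ka) (up k rho) =
  ((sumn ka == sumn rho + k)%N && interlacing ka rho).
Proof.
move=> srho cka; pose pad := mkseq (nth 0%N ka) (size rho).+1.
have padE i : interlacing ka rho -> nth 0%N pad i = nth 0%N ka i.
  move=> /interlacingP h; have [lt|ge] := ltnP i (size rho).+1.
    by rewrite nth_mkseq.
  rewrite nth_default ?size_mkseq //; case: i ge => // i; rewrite ltnS => ge.
  by have := h i; rewrite (nth_default _ ge); lia.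
have [/andP[/eqP es hk]|no] := boolP (_ && _); last first.
  rewrite [RHS]/= -(count_pred0 (up k rho)); apply: eq_in_count => tau ti.
  apply/negP => /(strip_eqP (sorted_up srho ti) cka) e; move/negP: no; apply.
  move: ti; rewrite mem_up => /and3P[_ /eqP sE /interlacingP h].
  rewrite -(eq_sumn e) sE eqxx; apply/interlacingP => i; rewrite -!e.
  exact: h.
transitivity (count_mem pad (up k rho)).
  apply: eq_in_count => tau ti; apply/(strip_eqP (sorted_up srho ti) cka)/eqP.
    move=> e; apply: (@eq_from_nth _ 0%N) => [|i _]; last by rewrite padE.
    by move: ti; rewrite mem_up size_mkseq => /and3P[/eqP].
  by move=> -> i; apply: padE.
rewrite count_uniq_mem ?uniq_up // mem_up size_mkseq eqxx.
have hp : interlacing pad rho.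
  by apply/interlacingP => i; rewrite !padE //; move/interlacingP: hk.
by rewrite (eq_sumn (fun i => padE i hk)) es eqxx hp.
Qed.

Lemma sumn_incr_nth s i : sumn (incr_nth s i) = (sumn s).+1.
Proof.
elim: s i => [|a s IH] [|i] //=.
- by rewrite add0n; elim: i.
- by rewrite IH addnS.
Qed.

Lemma exists_incr_nth s t : (forall i, nth 0 s i <= nth 0 t i)%N ->
  (sumn s < sumn t)%N ->
  exists x, forall i, (nth 0 (incr_nth s x) i <= nth 0 t i)%N.
Proof.
move=> le lt.
have [x hx] : exists x, (nth 0 s x < nth 0 t x)%N.
  apply/not_existsP => h.
  suff : (sumn t <= sumn s)%N by rewrite leqNgt lt.
  by apply: leq_sumn => i; rewrite leqNgt; apply/negP/h.
exists x => i; rewrite nth_incr_nth; case: eqP => [<- //|_].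
exact: le.
Qed.

Lemma add_one_box s t : (forall i, nth 0 s i <= nth 0 t i)%N ->
  sumn t = (sumn s).+1 ->
  exists x, forall i, nth 0%N t i = (nth 0%N s i + (i == x))%N.
Proof.
move=> le e; have [|x hx] := exists_incr_nth le; first by rewrite e.
exists x => i; rewrite -(sumn_leq_eq hx) ?sumn_incr_nth ?e //.
by rewrite nth_incr_nth addnC eq_sym.
Qed.

Lemma add_two_boxes s t : (forall i, nth 0 s i <= nth 0 t i)%N ->
  sumn t = (sumn s).+2 ->
  exists a b, (b <= a)%N /\
    forall i, nth 0%N t i = (nth 0%N s i + (i == a) + (i == b))%N.
Proof.
move=> le e; have [|x hx] := exists_incr_nth le; first by rewrite e.
have [|y hy] := add_one_box hx; first by rewrite sumn_incr_nth.
have E i : nth 0%N t i = (nth 0%N s i + (i == x) + (i == y))%N.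
  by rewrite hy nth_incr_nth [(x == i)]eq_sym; lia.
have [le'|lt] := leqP y x; first by exists x, y.
by exists y, x; split=> [|i]; [exact: ltnW | rewrite E; lia].
Qed.

Lemma two_boxes_unique (a b a' b' : nat) : (b <= a)%N -> (b' <= a')%N ->
  (forall i : nat, (i == a) + (i == b) = (i == a') + (i == b') :> nat)%N ->
  a = a' /\ b = b'.
Proof.
(* If c exceeded c', hence also d', the right side would vanish at c. *)
have le c d c' d' : (d' <= c')%N -> (forall i : nat,
    (i == c) + (i == d) = (i == c') + (i == d') :> nat)%N -> (c <= c')%N.
  move=> h e; rewrite leqNgt; apply/negP => lt; have := e c.
  by rewrite eqxx (gtn_eqF lt) (gtn_eqF (leq_ltn_trans h lt)).
move=> h h' e; have aE : a = a'.
  by apply/eqP; rewrite eqn_leq (le _ _ _ _ h' e) (le _ _ _ _ h (fun i => esym (e i))).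
split=> //; have := e b; rewrite -aE => /addnI; rewrite eqxx.
by case: eqP.
Qed.

Section Count.
Variables (nu ka : seq nat).
Let n := sumn nu.
Let v := nth 0%N nu 0.
Let la := (n + v).-1 :: ka.
Hypothesis nu_part : canonical_part nu.
Hypothesis nu_pos : (0 < nth 0 nu 0)%N.
Hypothesis la_part : canonical_part la.
Hypothesis la_sum : sumn la = (2 * n)%N.

Let nu_sorted : sorted geq nu. Proof. by case/andP: nu_part. Qed.
Let ka_part : canonical_part ka. Proof. exact: canonical_behead la_part. Qed.

(** The shapes between removing a box from nu^- and adding a horizontal strip to reach [ka]; they
    link Pieri's rule with I(la). *)
Definition strips : seq (seq nat) :=
  [seq rho <- removals nu | interlacing ka rho].

(** The removed box moves to the other side to stay in [nat]. Row 0 imposes no condition: x, a, b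
    are positive and the first row of [la] is n + v - 1. *)
Lemma obtainedP x a b : obtained nu la x a b <->
  [/\ (0 < x)%N, (nth 0 nu x.+1 < nth 0 nu x)%N, (0 < b <= a)%N,
      forall i, (nth 0 ka i + (i.+1 == x) =
                 nth 0 nu i.+1 + (i.+1 == a) + (i.+1 == b))%N
    & a <> b -> nth 0%N la a <> nth 0%N la b].
Proof.
have nv : (0 < n + v)%N by rewrite addn_gt0 nu_pos orbT.
rewrite /obtained /removable /bar /parts /eps.
split=> -[x0 rx ab e ne]; split=> //.
- by move: rx; case: x x0 {e} => // x _; rewrite /=; lia.
- by move=> i; have := e i.+1; rewrite /=; lia.
- by move=> /ne; lia.
- by case: x x0 rx {e} => // x _; rewrite /=; lia.
- case=> [|i]; last by have := e i; rewrite /=; lia.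
  by case: x x0 {rx e} => // x _; case: b a ab {ne} => // b [|a] //= _; rewrite /n /v; lia.
- by move=> /ne; lia.
Qed.

(** The pair uses the row numbers of [la], which exceed those of its tail [ka] by one. *)
Definition decomposes (rho : seq nat) (ab : nat * nat) : Prop :=
  (0 < ab.2 <= ab.1)%N /\
  forall i, nth 0%N ka i = (nth 0%N rho i + (i.+1 == ab.1) + (i.+1 == ab.2))%N.

Lemma decomposes_pair_unique rho ab ab' :
  decomposes rho ab -> decomposes rho ab' -> ab = ab'.
Proof.
case: ab ab' => [a b] [a' b'] [/= /andP[b0 h] e] [/= /andP[b0' h'] e'].
have [|->->//] := two_boxes_unique h h'.
case=> [|i]; first by lia.
by have := e i; rewrite e'; lia.
Qed.

Lemma decomposes_strip_unique rho rho' ab : size rho = size rho' ->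
  decomposes rho ab -> decomposes rho' ab -> rho = rho'.
Proof.
move=> sz [_ e] [_ e']; apply: (@eq_from_nth _ 0%N) => // i _.
by have := e i; rewrite e'; lia.
Qed.

Lemma stripsP rho : rho \in strips ->
  [/\ size rho = size nu, (sumn rho).+1 = sumn (behead nu),
      forall i, (nth 0 nu i.+2 <= nth 0 rho i <= nth 0 nu i.+1)%N
    & forall i, (nth 0 ka i.+1 <= nth 0 rho i <= nth 0 ka i)%N].
Proof.
rewrite mem_filter => /andP[/interlacingP h]; rewrite mem_filter => /andP[/eqP es].
rewrite mem_inter size_rcons size_behead.
move=> /andP[/eqP sz /interlacingP h']; split=> // [|i].
  by rewrite sz prednK //; case: (nu) nu_pos.
by have := h' i; rewrite !nth_rcons0 !nth_behead.
Qed.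

Lemma strips_decomposes rho : rho \in strips -> exists ab, decomposes rho ab.
Proof.
move=> /stripsP[sz es h h'].
have [|//|a [b [ab e]]] := @add_two_boxes rho ka.
- by move=> i; have := h' i; lia.
- have := sumn_behead nu; have := nth_leq_sumn nu 0; move: la_sum nu_pos.
  by rewrite /= -/n -/v; lia.
by exists (a.+1, b.+1); split=> // i; rewrite e.
Qed.

Lemma strip_obtained rho a b : rho \in strips -> decomposes rho (a, b) ->
  exists x, obtained nu la x a b.
Proof.
move=> /stripsP[sz es h h'] [/= ab e].
have [||x hx] := @add_one_box rho (behead nu).
- by move=> i; rewrite nth_behead; have := h i; lia.
- by rewrite -es.
exists x.+1; apply/obtainedP; split=> //.
- by have := hx x; have := h x; rewrite nth_behead eqxx; lia.
- by move=> i; have := hx i; rewrite e nth_behead; lia.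
(* In the rows of [ka], the strip condition gives ka_a <= ka_{b+1} <= rho_b < ka_b. *)
- move=> ne; case: b a ab e ne => [|b] [|a] //= ab e ne.
  have := e a; have := e b; have := h' b.
  have := geq_nth (i := b.+1) (j := a) (proj1 (andP ka_part)); lia.
Qed.

Lemma obtained_strip x a b : obtained nu la x a b ->
  exists2 rho, rho \in strips & decomposes rho (a, b).
Proof.
move=> /obtainedP[x0 rx ab e ne].
pose rho := mkseq (fun i => nth 0%N nu i.+1 - (i.+1 == x))%N (size nu).
have rhoE i : nth 0%N rho i = (nth 0%N nu i.+1 - (i.+1 == x))%N.
  have [lt|ge] := ltnP i (size nu); first by rewrite nth_mkseq.
  by rewrite !nth_default ?size_mkseq // leqW.
have nux : (0 < nth 0 nu x)%N by lia.
have snu := sorted_geqP _ nu_sorted; have ska := sorted_geqP _ (proj1 (andP ka_part)).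
have dE i : nth 0%N ka i = (nth 0%N rho i + (i.+1 == a) + (i.+1 == b))%N.
  by have := e i; rewrite rhoE; case: (i.+1 =P x) => [->|]; lia.
exists rho; last by [].
have hk : interlacing ka rho.
  apply/interlacingP => i; have := dE i; have := dE i.+1; have := ska i.
  have : (nth 0 rho i.+1 <= nth 0 rho i)%N.
    have := snu i.+1; rewrite !rhoE; case: (i.+1 =P x) => [xE|_]; last by lia.
    by move: rx; rewrite -xE; lia.
  move=> mono mono' d1 d0; apply/andP; split; last by lia.
  (* If the strip condition fails, the two boxes lie in adjacent rows, one above the other, so rows
     a and b of [la] are equal, against [ne]. *)
  rewrite leqNgt; apply/negP => lt.
  have aE : a = i.+2 by lia.
  have bE : b = i.+1 by lia.
  by move: ne d0 d1; rewrite aE bE /= => /(_ (elimN eqP _)); rewrite gtn_eqF // => /(_ isT); lia.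
rewrite mem_filter hk mem_filter mem_inter size_mkseq size_rcons size_behead /=.
have vE : (size nu).-1.+1 = size nu by case: (nu) nu_pos.
rewrite vE eqxx; apply/andP; split; last first.
  apply/interlacingP => i; rewrite !nth_rcons0 !nth_behead rhoE.
  have := snu i.+1; case: (i.+1 =P x) => [->|_]; lia.
have : sumn ka = (sumn rho + 2)%N.
  rewrite (@eq_sumn ka (incr_nth (incr_nth rho a.-1) b.-1)) => [|i].
    by rewrite !sumn_incr_nth addn2.
  by rewrite !nth_incr_nth dE; lia.
have := sumn_behead nu; have := nth_leq_sumn nu 0; move: la_sum nu_pos.
by rewrite /= -/n -/v; lia.
Qed.

(** Given [ka], the intermediate shape and the pair of rows determine each other. *)
Lemma card_Iset : #|` fset_set (Iset nu la)| = size strips.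
Proof.
pose h rho := xget (0, 0)%N [set ab | decomposes rho ab]%classic.
have hP rho : rho \in strips -> decomposes rho (h rho).
  by move=> /strips_decomposes[ab d]; apply: (xgetPex _ (ex_intro _ ab d)).
have -> : Iset nu la = [set` [fset ab in map h strips]%fset]%classic.
  apply/seteqP; split=> [[a b] [_ [x ox]]|[a b]] /=; rewrite !inE.
    have [rho rs d] := obtained_strip ox.
    apply/mapP; exists rho => //; exact: decomposes_pair_unique d (hP rho rs).
  move=> /mapP[rho rs e]; have d := hP rho rs; rewrite -e in d.
  have [x ox] := strip_obtained rs d; split; last by exists x.
  by split; [rewrite is_part_ofE la_part la_sum /= | exists x, a, b].
rewrite set_fsetK card_fseq undup_id ?size_map // map_inj_in_uniq.
  exact/filter_uniq/filter_uniq/uniq_inter.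
move=> rho rho' rs rs' e; have d := hP rho rs; rewrite e in d.
apply: decomposes_strip_unique d (hP rho' rs').
by case: (stripsP rs) => -> *; case: (stripsP rs') => ->.
Qed.

Lemma hall_plethysm_row2 : nth 0%N nu 0 = nth 0%N nu 1 ->
  hall (plethysm (schur nu) (schur [:: 2%N])) (schur la) =
  #|` fset_set (Iset nu la)|%:R -
  (strip (v.+1 :: rcons (drop 2 nu) 0%N) == ka)%:R.
Proof.
move=> nu01.
have [c hc] := schur_span_expands (plethysm_row2_schur_span (schur nu)).
rewrite (hall_schur hc la_part) (coef_first_row_subtop nu_part nu_pos nu01 hc ka_part).
congr (_%:R - _); rewrite card_Iset size_filter -sumn_count sumnE big_map.
apply: eq_big_seq => rho; rewrite mem_filter => /andP[/eqP es].
move=> ri; rewrite count_up_strip ?(sorted_inter ri) //.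
(* |ka| = 2n - (n + v - 1) = n - v + 1, while |rho| = n - v - 1. *)
have -> // : sumn ka == (sumn rho + 2)%N.
have := sumn_behead nu; have := nth_leq_sumn nu 0; move: la_sum nu_pos.
by rewrite /= -/n -/v; lia.
Qed.

End Count.

(** * The four cases of the multiplicity *)

Theorem corollary4p8 (n : nat) (nu la : seq nat)
    (n_gt0 : (0 < n)%N)
    (nu_part : is_part_of n nu)
    (nu_first_rows : nth 0%N nu 0 = nth 0%N nu 1)
    (la_part : is_part_of (2 * n) la)
    (la_first_row : nth 0%N la 0 = (n + nth 0%N nu 0 - 1)%N) :
  let mult := hall (plethysm (schur nu) (schur [:: 2%N])) (schur la) in
  let cardI := #|` fset_set (Iset nu la)|%:R in
  let case1 := exists x a b : nat,
    [/\ (0 < x)%N /\ (0 < a)%N /\ (0 < b)%N,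
        x <> a /\ x <> b,
        a <> b -> nth 0%N nu a <> nth 0%N nu b
      & forall i, parts la i =
          bar nu i - eps 0 i - eps x i + eps a i + eps b i] in
  let case2 := forall i, parts la i = bar nu i - eps 0 i + eps 1 i in
  let case3 := exists c : nat, (1 < c)%N /\
    forall i, parts la i = bar nu i - eps 0 i + eps c i in
  [/\ case1 -> mult = 1,
      case2 -> mult = cardI - 1,
      case3 -> mult = cardI
    & ~ case1 -> ~ case2 -> ~ case3 -> mult = 0].
Proof.
move=> mult cardI case1 case2 case3.
have [cnu /eqP snuE] : canonical_part nu /\ sumn nu == n.
  by move: nu_part; rewrite is_part_ofE => /andP.
have [cla /eqP slaE] : canonical_part la /\ sumn la == (2 * n)%N.
  by move: la_part; rewrite is_part_ofE => /andP.
have nu_pos : (0 < nth 0 nu 0)%N.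
  case: (nu) cnu snuE => [|v s]; first by move=> _ /= e; rewrite -e in n_gt0.
  by case/andP=> _; rewrite inE negb_or => /andP[]; rewrite /= lt0n eq_sym.
have laE : la = (sumn nu + nth 0%N nu 0).-1 :: behead la.
  move: la_first_row; rewrite snuE.
  case: (la) => [|l0 s] /=; first by lia.
  by move=> ->; rewrite subn1.
have nusort := sorted_geqP _ (proj1 (andP cnu)).
have lasort := sorted_geqP _ (proj1 (andP cla)).
have cka := canonical_behead cla.
set y := (nth 0%N nu 0).+1 :: rcons (drop 2 nu) 0%N.
have multE : mult = cardI - (strip y == behead la)%:R.
  rewrite /mult /cardI laE; apply: hall_plethysm_row2 => //; first by rewrite -laE.
  by rewrite -laE snuE.
have sy : sorted geq y.
  apply/sorted_geqP => -[|i]; rewrite /y /= !nth_rcons0 !nth_drop; last exact: nusort.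
  by have := nusort 1%N; rewrite /= -nu_first_rows addn0; lia.
(* The correction -1 occurs exactly in the second case, where the tail of [la] is nu^- + eps_1. *)
have case2P : reflect case2 (strip y == behead la).
  apply: (iffP (strip_eqP sy cka)) => [e [|i]|e i].
  - by rewrite /parts /bar /eps la_first_row /parts snuE /=; lia.
  - rewrite /parts /bar /eps /= -nth_behead -e.
    case: i => [|i]; first by rewrite /= /parts -nu_first_rows; lia.
    by rewrite /= nth_rcons0 nth_drop /parts add2n; lia.
  - have := e i.+1; rewrite nth_behead /parts /bar /eps /parts.
    case: i => [|i] /=; first by rewrite -nu_first_rows; lia.
    by rewrite nth_rcons0 nth_drop add2n; lia.
have IP a b : Iset nu la (a, b) <-> exists x, obtained nu la x a b.
  split=> [[]//|[x ox]]; split; last by exists x.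
  by split; [rewrite snuE | exists x, a, b].
split.
- have aux x a b : (0 < x)%N -> (0 < b <= a)%N -> x <> a -> x <> b ->
      (a <> b -> nth 0%N nu a <> nth 0%N nu b) ->
      (forall i, parts la i = bar nu i - eps 0 i - eps x i + eps a i + eps b i) ->
      mult = 1.
    move=> x0 ab xa xb ne e; rewrite multE.
    have ox : obtained nu la x a b.
      split=> // [|/ne].
        (* Row x receives no new box, so nu_{x+1} <= la_{x+1} <= la_x < nu_x, which is
           removability. *)
        have := e x; have := e x.+1; have := lasort x.
        by rewrite /removable /parts /bar /eps /parts; lia.
      by have := e a; have := e b; rewrite /parts /bar /eps /parts; lia.
    have IE : Iset nu la = [set (a, b)]%classic.
      apply/seteqP; split=> [[a' b'] /IP[x' [x'0 rx' /andP[_ ab'] e' _]]|_ ->].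
        have E i : ((i == a') + (i == b') + (i == x) = (i == a) + (i == b) + (i == x'))%N.
          by have := e i; rewrite e' /eps; lia.
        (* At row x the left side of [E] is at least 1, which forces x' = x; the pair is then
           determined too. *)
        have xx : x' = x by have := E x; lia.
        have [i|-> ->] // := two_boxes_unique ab' (proj2 (andP ab)).
        by have := E i; rewrite xx; lia.
      by apply/IP; exists x.
    (* The second case is excluded: here row x loses a box, there only the first row does. *)
    rewrite /cardI IE fset_set1 cardfs1; case: case2P => [e2|_]; last by rewrite subr0.
    by have := e x; rewrite e2 /eps; lia.
  move=> [x [a [b [[x0 [a0 b0]] [xa xb] ne e]]]].
  have [le|lt] := leqP b a; first by apply: (aux x a b) => //; rewrite b0.
  apply: (aux x b a) => //; first by rewrite a0 ltnW.
    by move=> /nesym/ne/nesym.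
  by move=> i; rewrite e addrAC.
- by move=> /case2P h2; rewrite multE h2.
- move=> [c [c1 e]]; rewrite multE; case: case2P => [e2|_]; last by rewrite subr0.
  by have := e c; rewrite e2 /eps; lia.
- move=> n1 n2 n3; rewrite multE; case: case2P => // _; rewrite subr0.
  rewrite /cardI (_ : Iset nu la = set0) ?fset_set0 ?cardfs0 //.
  apply/seteqP; split=> // -[a b] /IP[x [x0 rx /andP[b0 ab] e ne]] /=.
  (* If x is a or b, the removed box is put back, and the position of the other box decides between
     the second and the third case. *)
  have [xa|xa] := eqVneq x a.
    have [b1|b1] := eqVneq b 1%N.
      by apply: n2 => i; rewrite e xa b1; lia.
    by apply: n3; exists b; split; [lia | move=> i; rewrite e xa; lia].
  have [xb|xb] := eqVneq x b.
    have [a1|a1] := eqVneq a 1%N.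
      by apply: n2 => i; rewrite e xb a1; lia.
    by apply: n3; exists a; split; [lia | move=> i; rewrite e xb; lia].
  apply: n1; exists x, a, b; split=> //.
  - by split=> //; split=> //; apply: leq_trans ab.
  - by split; apply/eqP.
  - move=> nab; have := ne nab; have := e a; have := e b.
    by rewrite /parts /bar /eps /parts; lia.
Qed.
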